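(* Let $r$ and $t$ be integers with $2\leq t\leq r-1$, and let $\alpha,\gamma$ be real numbers with $0\leq\alpha\leq 1$ and $0\leq\gamma\leq\frac{r-2}{2(r-1)}$. Let $\beta=\beta(r,t,\alpha,\gamma)$ be the function defined in the context. If $G$ is an $n$-vertex $K_{r}$-free graph with at least $\gamma n^{2}$ edges, then every $\lceil\alpha n\rceil$-vertex subset of $V(G)$ spans (i.e. induces a subgraph containing) at least $\lfloor\beta n^{t}\rfloor$ copies of $K_{t}$.
   Context: Graphs are finite and simple. Copies of $K_t$ are counted as $t$-element vertex sets inducing a complete graph. For integers $r\ge 3$ and $2\le s\le r$ and real $0\le\gamma\le\frac{r-2}{2(r-1)}$, write \[d(s)=d_{r,\gamma}(s):=\sqrt{\frac{2(s-1)(r-s)}{r-1}\left(\frac{r-2}{2(r-1)}-\gamma\right)}.\] For integers $2\le t\le r-1$ and real $0\le\alpha\le 1$, $0\le\gamma\le\frac{r-2}{2(r-1)}$, the function $\beta(r,t,\alpha,\gamma)$ is defined as follows (with the convention $\binom{s-1}{t}=0$ when $t=s$). (1) If $0\leq\alpha\leq \frac{t-1}{r-1}+d(t)$, then $\beta(r,t,\alpha,\gamma)=0$. (2) If $s$ is an integer with $t\leq s\leq r-1$ and $\frac{s-1}{r-1}+d(s)<\alpha\leq \frac{s}{r-1}+\frac{r-s-1}{r-s}d(s)$, then \[\beta(r,t,\alpha,\gamma)=\binom{s-1}{t}\left(\frac{1}{r-1}+\frac{d(s)}{s-1}\right)^t+\binom{s-1}{t-1}\left(\frac{1}{r-1}+\frac{d(s)}{s-1}\right)^{t-1}\left(\alpha-\frac{s-1}{r-1}-d(s)\right).\]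 (3) If $s$ is an integer with $t\leq s\leq r-2$ and $\frac{s}{r-1}+\frac{r-s-1}{r-s}d(s)<\alpha\leq \frac{s}{r-1}+d(s+1)$, then \[\beta(r,t,\alpha,\gamma)=\binom{s-1}{t}L^t+\binom{s-1}{t-1}L^{t-1}\left(\alpha-(s-1)L\right),\] where $L$ is the unique real solution of \[\binom{s-1}{2}L^2+(s-1)L\left(\alpha-(s-1)L\right)=\gamma-\alpha(1-\alpha)-\frac{r-s-2}{2(r-s-1)}(1-\alpha)^2\] in the range \[\frac{s-1}{s}\left(\frac{s}{r-1}+d(s+1)\right)\leq (s-1)L\leq \frac{s-1}{r-1}+d(s).\] *)

(* Defs.v *)
From mathcomp Require Import all_boot all_order all_algebra.
From mathcomp Require Import boolp classical_sets reals.

Set Implicit Arguments.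
Unset Strict Implicit.
Unset Printing Implicit Defensive.

Import Order.TTheory GRing.Theory Num.Theory.

Local Open Scope ring_scope.

Record sgraph (V : finType) := SGraph {
  adj :> rel V;
  adj_sym : symmetric adj;
  adj_irr : irreflexive adj
}.

Section Graphs.
Variables (V : finType) (G : sgraph V).

Definition edges : {set {set V}} :=
  [set A : {set V} | [exists x, exists y, adj G x y && (A == [set x; y])%SET]].

Definition clique (A : {set V}) : bool :=
  [forall x in A, forall y in A, (x != y) ==> adj G x y].

Definition Kcopies (S : {set V}) (t : nat) : {set {set V}} :=
  [set A : {set V} | [&& A \subset S, #|A| == t & clique A]].

Definition Kfree (r : nat) : Prop := Kcopies [set: V]%SET r = finset.set0.

End Graphs.

Section Beta.
Variable R : realType.
Implicit Types (r t s : nat) (alpha gamma L b : R).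

Definition d r gamma s : R :=
  Num.sqrt ((2 * (s%:R - 1) * (r%:R - s%:R)) / (r%:R - 1)
            * ((r%:R - 2) / (2 * (r%:R - 1)) - gamma)).

Definition is_L r alpha gamma s L : Prop :=
  [/\ 'C(s - 1, 2)%:R * L ^+ 2
        + (s%:R - 1) * L * (alpha - (s%:R - 1) * L)
      = gamma - alpha * (1 - alpha)
        - (r%:R - s%:R - 2) / (2 * (r%:R - s%:R - 1)) * (1 - alpha) ^+ 2,
      (s%:R - 1) / s%:R * (s%:R / (r%:R - 1) + d r gamma s.+1)
        <= (s%:R - 1) * L
    & (s%:R - 1) * L <= (s%:R - 1) / (r%:R - 1) + d r gamma s].

Inductive beta_spec r t alpha gamma : R -> Prop :=
| beta_case1 :
    0 <= alpha <= (t%:R - 1) / (r%:R - 1) + d r gamma t ->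
    beta_spec r t alpha gamma 0
| beta_case2 s :
    (t <= s <= r - 1)%N ->
    (s%:R - 1) / (r%:R - 1) + d r gamma s < alpha
      <= s%:R / (r%:R - 1) + (r%:R - s%:R - 1) / (r%:R - s%:R) * d r gamma s ->
    beta_spec r t alpha gamma
      ('C(s - 1, t)%:R * (1 / (r%:R - 1) + d r gamma s / (s%:R - 1)) ^+ t
       + 'C(s - 1, t - 1)%:R
         * (1 / (r%:R - 1) + d r gamma s / (s%:R - 1)) ^+ (t - 1)
         * (alpha - (s%:R - 1) / (r%:R - 1) - d r gamma s))
| beta_case3 s L :
    (t <= s <= r - 2)%N ->
    s%:R / (r%:R - 1) + (r%:R - s%:R - 1) / (r%:R - s%:R) * d r gamma s < alpha
      <= s%:R / (r%:R - 1) + d r gamma s.+1 ->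
    is_L r alpha gamma s L ->
    beta_spec r t alpha gamma
      ('C(s - 1, t)%:R * L ^+ t
       + 'C(s - 1, t - 1)%:R * L ^+ (t - 1) * (alpha - (s%:R - 1) * L)).

(* For 2 <= t <= r - 1, 0 <= alpha <= 1 and
   0 <= gamma <= (r - 2) / (2 (r - 1)), exactly one case and one index s apply,
   and is_L then has exactly one solution: put k = r - 1,
   x = alpha - s / k and q = 2 / k * ((k - 1) / (2 k) - gamma); the equation is
     s (s - 1) (L - alpha / s)^2 + x^2 k / (s (k - s)) = q k
   and the range of L lies above alpha / s, where the left-hand side increases.
   So a value satisfying beta_spec exists and is unique there; the default 0 of
   xget is only reached outside these parameter ranges. *)
Definition beta r t alpha gamma : R :=
  xget 0 (beta_spec r t alpha gamma).

End Beta.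

(* Main.v *)
(* Give every vertex a weight and count cliques with multiplicative weights.
   Two extremal problems are solved by looking at a minimiser.

   (1) Clique density (after Reiher).  Let x be a vertex weighting of mass 1 and
   a a symmetric function with values in [0, 1] (loops allowed).  If the edge sum
   of (a, x) is at least that of a complete multipartite graph whose parts have
   weight L except for one smaller part, then so is the K_t sum.  Minimise the
   difference of the K_t sums over a, x and L together.  Stationarity in x makes
   the K_(t-1) sum of the link of v an affine function of the degree of v, and
   stationarity in a bounds the K_(t-2) sums of links.  The slope and the constant
   of the affine function define a part size L' > L; the induction hypothesis for
   the links, the Moon-Moser inequalities and a Bonferroni inequality then show that
   the edge sum is at most the one belonging to L', which is too small.

   (2) Local edge density.  Split a weighting of mass 1 of a K_r-free graph as
   p + q and bound the edge sum of p in terms of its mass and of the edge sum of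
   p + q.  At a minimiser for which the support of q is smallest, the Kuhn-Tucker
   conditions determine the degrees on the supports, the support of q is a clique,
   and K_r-freeness limits its size and the size of the cliques of supp p that are
   joined to it.

   For the theorem, take p + q uniform with p of mass alpha on S; (2) gives the
   edge sum of p, and (1) turns it into a K_t sum. *)

(* Edge weights in [0, 1] on all pairs, loops included, make the feasible set of (1) compact, allow
   infinitesimal changes of a single edge, and allow a vertex to be compared with a twin of itself.
   Varying L as well makes the Lagrange multiplier explicit: the derivatives in L of the two
   comparison sums are proportional, with factor C(q+2, 2) (s^_q) L^q. In both problems the edge
   constraint may be tight at the minimiser. A variation that affects it is therefore compensated by
   moving the part size (L or X) so that the slack of the constraint grows at a rate fixed by a
   small positive number, which then tends to 0. At the ends of the range of the part size there is
   no room for this. Those values are treated separately, by Turan's bound where the parts are equal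
   and by a direct estimate where the small parts of (2) vanish. The bound in (2) has two regimes:
   what p has beyond S large parts fits into one small part, or it does not. These are cases 2 and 3
   of [beta]. *)
Require Import Defs.
From mathcomp Require Import all_boot all_order all_algebra.
From mathcomp Require Import boolp classical_sets reals.
From mathcomp Require Import topology normedtype derive.
From mathcomp Require Import polyrcf ring lra zify.

Set Implicit Arguments.
Unset Strict Implicit.
Unset Printing Implicit Defensive.

Import Order.TTheory GRing.Theory Num.Theory numFieldNormedType.Exports.

Local Open Scope ring_scope.

(** * Weighted clique sums *)

Section CliqueSums.
Variables (R : comNzRingType) (V : finType).
Implicit Types (a : V -> V -> R) (x y b c : V -> R) (Phi Psi : (V -> R) -> R).

(* [ksum a r x] is the sum over all r-tuples (v_1, ..., v_r) of the product of the
   x(v_i) and of the a(v_i, v_j), i < j. *)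
Fixpoint kfold a Phi r x : R :=
  if r is r'.+1 then \sum_v x v * kfold a Phi r' (fun u => x u * a v u)
  else Phi x.

Definition ksum a := kfold a (fun=> 1).

Definition mass x := \sum_v x v.

Lemma eq_kfold a Phi Psi r x y :
  (forall x' y', x' =1 y' -> Phi x' = Psi y') -> x =1 y ->
  kfold a Phi r x = kfold a Psi r y.
Proof.
move=> eqPhi; elim: r x y => [|r IH] x y exy /=; first exact: eqPhi.
by apply: eq_bigr => v _; rewrite exy; congr (_ * _); apply: IH => u; rewrite exy.
Qed.

Lemma eq_ksum a r x y : x =1 y -> ksum a r x = ksum a r y.
Proof. exact: eq_kfold. Qed.

Lemma ksum0 a x : ksum a 0 x = 1. Proof. by []. Qed.

Lemma ksumS a r x :
  ksum a r.+1 x = \sum_v x v * ksum a r (fun u => x u * a v u).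
Proof. by []. Qed.

Lemma ksum1 a x : ksum a 1 x = mass x.
Proof. by rewrite ksumS; apply: eq_bigr => v _; rewrite ksum0 mulr1. Qed.

Lemma ksum2 a x :
  ksum a 2 x = \sum_v x v * (\sum_u x u * a v u).
Proof. by rewrite ksumS; apply: eq_bigr => v _; rewrite ksum1. Qed.

Lemma eq_mass x y : x =1 y -> mass x = mass y.
Proof. by move=> e; apply: eq_bigr => v _. Qed.

Lemma kfoldD a Phi Psi r x :
  kfold a (fun y => Phi y + Psi y) r x = kfold a Phi r x + kfold a Psi r x.
Proof.
elim: r x => [//|r IH] x /=; rewrite -big_split; apply: eq_bigr => v _.
by rewrite IH mulrDr.
Qed.

Lemma kfoldZ a (c : R) Phi r x :
  kfold a (fun y => c * Phi y) r x = c * kfold a Phi r x.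
Proof.
elim: r x => [//|r IH] x /=; rewrite mulr_sumr; apply: eq_bigr => v _.
by rewrite IH mulrCA.
Qed.

Lemma kfold_kfold a Phi r s x :
  kfold a (kfold a Phi s) r x = kfold a Phi (r + s) x.
Proof.
by elim: r x => [//|r IH] x /=; apply: eq_bigr => v _; rewrite IH.
Qed.

Lemma ksumSr a r x : ksum a r.+1 x = kfold a mass r x.
Proof.
rewrite /ksum -addn1 -kfold_kfold; apply: eq_kfold => // y z eyz.
by rewrite -/(ksum a 1 y) ksum1 (eq_mass eyz).
Qed.

Lemma ksumZ a (c : R) r x : ksum a r (fun u => c * x u) = c ^+ r * ksum a r x.
Proof.
elim: r x => [|r IH] x; first by rewrite !ksum0 mulr1.
rewrite !ksumS mulr_sumr; apply: eq_bigr => v _.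
have -> : ksum a r (fun u => c * x u * a v u)
        = ksum a r (fun u => c * (x u * a v u)).
  by apply: eq_ksum => u; rewrite mulrA.
by rewrite IH exprS; ring.
Qed.

Variable a : V -> V -> R.
Hypothesis a_sym : forall u v, a u v = a v u.

Lemma ksum_pair r x b c :
  \sum_v x v * b v * \sum_u x u * a v u * c u
      * ksum a r (fun w => x w * a v w * a u w)
  = \sum_u x u * c u * \sum_v x v * a u v * b v
      * ksum a r (fun w => x w * a u w * a v w).
Proof.
under eq_bigr do rewrite mulr_sumr.
rewrite exchange_big; apply: eq_bigr => u _ /=; rewrite mulr_sumr.
apply: eq_bigr => v _; rewrite (a_sym v u).
have -> : ksum a r (fun w => x w * a v w * a u w)
        = ksum a r (fun w => x w * a u w * a v w).
  by apply: eq_ksum => w; rewrite mulrAC.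
ring.
Qed.

Lemma ksum_point r x b :
  \sum_v x v * b v * ksum a r.+1 (fun u => x u * a v u)
  = \sum_v x v * \sum_u x u * a v u * b u
       * ksum a r (fun w => x w * a v w * a u w).
Proof.
transitivity (\sum_v x v * b v * \sum_u x u * a v u * 1
      * ksum a r (fun w => x w * a v w * a u w)).
  apply: eq_bigr => v _; rewrite ksumS; congr (_ * _).
  by apply: eq_bigr => u _; rewrite mulr1.
by rewrite ksum_pair; apply: eq_bigr => v _; rewrite mulr1.
Qed.

(** By symmetry of [a] the marked vertex may be the first or the last of the tuple. *)
Lemma ksum_polar r x b :
  \sum_v x v * b v * ksum a r (fun u => x u * a v u)
  = kfold a (fun y => \sum_v y v * b v) r x.
Proof.
elim: r x => [|r IH] x /=; first by apply: eq_bigr => v _; rewrite ksum0 mulr1.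
by rewrite ksum_point; apply: eq_bigr => v _; rewrite -IH.
Qed.

(** The sum over r-tuples of (b(v_1) + ... + b(v_r)) times the clique weight; symmetry puts the
    marked vertex first, hence the factor r. *)
Definition ksum_at b r x :=
  r%:R * \sum_v x v * b v * ksum a r.-1 (fun u => x u * a v u).

(** The sum over positions i < j of the clique sums in which a(v_i, v_j) is replaced by h(v_i,
    v_j). *)
Definition ksum_at2 (h : V -> V -> R) r x :=
  'C(r, 2)%:R * \sum_v x v * \sum_u x u * h v u
     * ksum a r.-2 (fun w => x w * a v w * a u w).

Lemma ksum_atS b r x :
  ksum_at b r.+1 x = \sum_v x v * b v * ksum a r (fun u => x u * a v u)
    + \sum_v x v * ksum_at b r (fun u => x u * a v u).
Proof.
rewrite /ksum_at /= -addn1 natrD mulrDl mul1r [LHS]addrC; congr (_ + _).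
case: r => [|r].
  by rewrite mul0r big1 // => v _; rewrite !mul0r mulr0.
rewrite ksum_point mulr_sumr; apply: eq_bigr => v _.
by rewrite mulrCA.
Qed.

Lemma ksum_at2S h r x :
  ksum_at2 h r.+1 x
  = r%:R * (\sum_v x v * \sum_u x u * h v u
       * ksum a r.-1 (fun w => x w * a v w * a u w))
    + \sum_v x v * ksum_at2 (fun u w => h u w) r (fun u => x u * a v u).
Proof.
rewrite /ksum_at2 /= binS bin1 natrD mulrDl [LHS]addrC; congr (_ + _).
case: r => [|[|r]].
- by rewrite !mul0r big1 // => v _; rewrite !mul0r mulr0.
- by rewrite !mul0r big1 // => v _; rewrite !mul0r mulr0.
transitivity ('C(r.+2, 2)%:R * \sum_v x v * \sum_u x u * a v u *
    \sum_w x w * a v w * h u w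
      * ksum a r (fun z => x z * a v z * a u z * a w z)); last first.
  by rewrite mulr_sumr; apply: eq_bigr => v _; rewrite mulrCA.
congr (_ * _) => /=.
under [RHS]eq_bigr do rewrite mulr_sumr.
rewrite [RHS]exchange_big; apply: eq_bigr => u _ /=.
under [RHS]eq_bigr do rewrite !mulr_sumr.
rewrite [RHS]exchange_big mulr_sumr; apply: eq_bigr => w _ /=.
rewrite ksumS !mulr_sumr; apply: eq_bigr => v _.
rewrite (a_sym u v) (a_sym w v).
have -> : ksum a r (fun z => x z * a u z * a w z * a v z)
        = ksum a r (fun z => x z * a v z * a u z * a w z).
  by apply: eq_ksum => z; ring.
ring.
Qed.

End CliqueSums.

Lemma map_ksum (R S : comNzRingType) (f : {rmorphism R -> S}) (V : finType)
    (a : V -> V -> R) r (x : V -> R) :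
  f (ksum a r x) = ksum (fun u v => f (a u v)) r (fun v => f (x v)).
Proof.
elim: r x => [|r IH] x; first by rewrite !ksum0 rmorph1.
rewrite !ksumS rmorph_sum; apply: eq_bigr => v _.
rewrite rmorphM IH; congr (_ * _).
by apply: eq_ksum => u; rewrite rmorphM.
Qed.

(** The product rule for polynomial entries; variations along a segment are then differentiated
    algebraically. *)
Lemma deriv_ksum (R : comNzRingType) (V : finType)
    (a : V -> V -> {poly R}) r (x : V -> {poly R}) :
    (forall u v, a u v = a v u) ->
  (ksum a r x)^`()
  = r%:R * (\sum_v (x v)^`() * ksum a r.-1 (fun u => x u * a v u))
    + ksum_at2 a (fun u v => (a u v)^`()) r x.
Proof.
move=> a_sym; elim: r x => [|r IH] x.
  by rewrite ksum0 derivC /ksum_at2 !mul0r addr0.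
rewrite ksumS raddf_sum /= ksum_at2S //.
under eq_bigr do rewrite derivM IH mulrDr.
rewrite !big_split /= -natr1 mulrDl mul1r.
rewrite -[RHS]addrA [RHS]addrCA addrA -addrA; congr (_ + _).
rewrite addrA; congr (_ + _).
case: r {IH} => [|r].
  by rewrite !mul0r addr0 big1 // => v _; rewrite mul0r mulr0.
rewrite -mulrDr; under eq_bigr do rewrite mulrCA.
rewrite -mulr_sumr; congr (_ * _).
transitivity (\sum_v (x v * (\sum_u (x u)^`() * a v u
      * ksum a r (fun w => x w * a v w * a u w))
    + x v * (\sum_u x u * (a v u)^`()
      * ksum a r (fun w => x w * a v w * a u w)))).
  apply: eq_bigr => v _; rewrite -mulrDr -big_split; congr (_ * _).
  by apply: eq_bigr => u _; rewrite derivM mulrDl.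
rewrite big_split /=; congr (_ + _).
under [RHS]eq_bigr do rewrite ksumS mulr_sumr.
rewrite [RHS]exchange_big; apply: eq_bigr => v _.
rewrite mulr_sumr; apply: eq_bigr => u _ /=.
have -> : ksum a r (fun w => x w * a v w * a u w)
        = ksum a r (fun w => x w * a u w * a v w).
  by apply: eq_ksum => w; rewrite mulrAC.
rewrite (a_sym v u); ring.
Qed.

(** * Moon-Moser and Bonferroni inequalities *)

Section OrderedCliqueSums.
Variables (R : realFieldType) (V : finType).
Implicit Types (a : V -> V -> R) (x y b : V -> R) (Phi Psi : (V -> R) -> R).

Definition edge_weights a :=
  (forall u v, a u v = a v u) /\ (forall u v, 0 <= a u v <= 1).

Variable a : V -> V -> R.
Hypothesis a_w : edge_weights a.

Let a_sym u v : a u v = a v u. Proof. by case: a_w. Qed.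
Let a_ge0 u v : 0 <= a u v. Proof. by case: a_w => _ /(_ u v) /andP[]. Qed.
Let a_le1 u v : a u v <= 1. Proof. by case: a_w => _ /(_ u v) /andP[]. Qed.

Lemma kfold_le Phi Psi r x :
  (forall y, (forall v, 0 <= y v <= x v) -> Phi y <= Psi y) ->
  (forall v, 0 <= x v) -> kfold a Phi r x <= kfold a Psi r x.
Proof.
elim: r x => [|r IH] x le_PhiPsi x0 /=.
  by apply: le_PhiPsi => v; rewrite x0 lexx.
apply: ler_sum => v _; apply: ler_wpM2l => //; apply: IH => [y yx|u]; last exact: mulr_ge0.
apply: le_PhiPsi => u; have /andP[-> yu] := yx u.
by apply: le_trans yu _; rewrite ler_piMr.
Qed.

Lemma ksum_ge0 r x : (forall v, 0 <= x v) -> 0 <= ksum a r x.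
Proof.
move=> x0; have -> : 0 = kfold a (fun=> 0) r x.
  elim: r x {x0} => [//|r IH] x /=.
  by rewrite big1 // => v _; rewrite -IH mulr0.
by apply: kfold_le.
Qed.

Lemma ksum_mono r x y :
  (forall v, 0 <= x v <= y v) -> ksum a r x <= ksum a r y.
Proof.
elim: r x y => [//|r IH] x y xy; rewrite !ksumS; apply: ler_sum => v _.
have /andP[x0 xv] := xy v.
apply: ler_pM => //.
  by apply: ksum_ge0 => u; have /andP[xu0 _] := xy u; apply: mulr_ge0.
apply: IH => u; have /andP[xu0 xu] := xy u.
by rewrite mulr_ge0 // ler_wpM2r.
Qed.

Lemma ksumS_le r x :
  (forall v, 0 <= x v) -> ksum a r.+1 x <= mass x * ksum a r x.
Proof.
move=> x0; rewrite ksumS mulr_suml; apply: ler_sum => v _.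
apply: ler_wpM2l => //; apply: ksum_mono => u.
by rewrite mulr_ge0 // ler_piMr.
Qed.

(** A second moment: y is the weight on the common neighbourhood of an r-tuple. The induction
    hypothesis in the links supplies all copies of the left-hand sum but one; the last one comes
    from (1 - a v u) (x u - y u) >= 0, summed over v and u with weight y v. *)
Lemma moon_moser_fold r x : (forall v, 0 <= x v) ->
  r.+1%:R * kfold a (fun y => mass y ^+ 2) r x
    <= mass x * ksum a r.+1 x + r%:R * ksum a r.+2 x.
Proof.
elim: r x => [|r IH] x x0.
  by rewrite ksum1 mul1r mul0r addr0 /= expr2 lexx.
rewrite -[r.+2%:R]natr1 mulrDl mul1r.
have step : r.+1%:R * kfold a (fun y => mass y ^+ 2) r.+1 x
    <= (\sum_v x v * (\sum_u x u * a v u) * ksum a r.+1 (fun u => x u * a v u))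
       + r%:R * ksum a r.+3 x.
  rewrite /= [ksum a r.+3 x]ksumS !mulr_sumr -big_split; apply: ler_sum => v _ /=.
  have := IH (fun u => x u * a v u) (fun u => mulr_ge0 (x0 u) (a_ge0 v u)).
  move/(ler_wpM2l (x0 v)); rewrite mulrDr !mulrA.
  by rewrite ![x v * _%:R]mulrC.
suff corr : (\sum_v x v * (\sum_u x u * a v u) * ksum a r.+1 (fun u => x u * a v u))
    + kfold a (fun y => mass y ^+ 2) r.+1 x
    <= mass x * ksum a r.+2 x + ksum a r.+3 x.
  rewrite -[r.+1%:R]natr1 mulrDl; have := step; rewrite -natr1; lra.
rewrite ksum_polar // [ksum a r.+2 x]ksumSr -kfoldZ -kfoldD.
have -> : ksum a r.+3 x = kfold a (ksum a 2) r.+1 x.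
  by rewrite /ksum kfold_kfold addn2.
rewrite -kfoldD; apply: kfold_le => // y yx.
rewrite ksum2 expr2.
have -> : mass y * mass y = \sum_v y v * mass y by rewrite mulr_suml.
have -> : mass x * mass y = \sum_v y v * mass x by rewrite mulrC mulr_suml.
rewrite -!big_split /=; apply: ler_sum => v _.
rewrite -!mulrDr; apply: ler_wpM2l; first by case/andP: (yx v).
rewrite -!big_split; apply: ler_sum => u _ /=.
have /andP[] := yx u; have := a_ge0 v u; have := a_le1 v u.
move: (a v u) (x u) (y u) => p q r' *; nra.
Qed.

(** Cauchy-Schwarz over r-tuples, in the form that the sum of (T_r * mass y - T_(r+1))^2 is
    nonnegative, reduces this to the second moment. *)
Lemma moon_moser r x : (forall v, 0 <= x v) ->
  r.+1%:R * ksum a r.+1 x ^+ 2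
    <= ksum a r x * (mass x * ksum a r.+1 x + r%:R * ksum a r.+2 x).
Proof.
move=> x0; have Tr := ksum_ge0 r x0.
apply: le_trans (ler_wpM2l Tr (moon_moser_fold r x0)).
rewrite [leRHS]mulrCA ler_wpM2l //.
have [Tr0|Tr_neq0] := eqVneq (ksum a r x) 0.
  have := ksumS_le r x0; have := ksum_ge0 r.+1 x0; rewrite Tr0 mulr0 mul0r.
  by move=> ge0 le0; rewrite expr2; nra.
have Tpos : 0 < ksum a r x by rewrite lt_neqAle eq_sym Tr_neq0.
have : 0 <= kfold a (fun y => (ksum a r x * mass y - ksum a r.+1 x) ^+ 2) r x.
  have -> : 0 = kfold a (fun=> 0 * 1) r x by rewrite kfoldZ mul0r.
  by apply: kfold_le => // y _; rewrite mul0r sqr_ge0.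
have -> : kfold a (fun y => (ksum a r x * mass y - ksum a r.+1 x) ^+ 2) r x
  = kfold a (fun y => (ksum a r x ^+ 2 * mass y ^+ 2
      + (- 2 * ksum a r x * ksum a r.+1 x) * mass y) + ksum a r.+1 x ^+ 2 * 1) r x.
  apply: eq_kfold => // y z eyz; rewrite (eq_mass eyz); ring.
rewrite !kfoldD !kfoldZ -/(ksum a r x) -ksumSr.
move: (kfold _ _ _ _) (ksum a r x) (ksum a r.+1 x) Tpos => K T S T0 h.
rewrite -(ler_pM2l T0); lra.
Qed.

(* For a complete p-partite graph with parts of weight M the ratio
   T_(j+1) / T_j is mass - j M; along a Moon-Moser chain the M so defined
   is nonincreasing in j. *)
Lemma ratio_up r x M : (forall v, 0 <= x v) ->
  0 < ksum a r x -> 0 <= ksum a r.+1 x ->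
  ksum a r x * (mass x - r%:R * M) <= ksum a r.+1 x -> (0 < r)%N ->
  ksum a r.+1 x * (mass x - r.+1%:R * M) <= ksum a r.+2 x.
Proof.
move=> x0 T0 S0 h r0; have := moon_moser r x0.
have rR : 0 < r%:R :> R by rewrite ltr0n.
move: (ksum a r x) (ksum a r.+1 x) (ksum a r.+2 x) (mass x) T0 S0 h
  => T S U m T0 S0 h mm.
have h' : S * (r.+1%:R * S) <= T * (m * S + r%:R * U).
  by move: mm; lra.
have h2 : S * (r.+1%:R * (T * (m - r%:R * M))) <= T * (m * S + r%:R * U).
  by apply: le_trans h'; apply: ler_wpM2l => //; apply: ler_wpM2l.
have : T * r%:R * (S * (m - r.+1%:R * M)) <= T * r%:R * U.
  by move: h2; rewrite -natr1; lra.
by rewrite ler_pM2l // mulr_gt0.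
Qed.

Lemma ratio_down r x M : (forall v, 0 <= x v) ->
  0 <= ksum a r x -> 0 < ksum a r.+1 x ->
  ksum a r.+2 x <= ksum a r.+1 x * (mass x - r.+1%:R * M) ->
  ksum a r.+1 x <= ksum a r x * (mass x - r%:R * M).
Proof.
move=> x0 T0 S0 h; have := moon_moser r x0.
have rR : 0 < r.+1%:R :> R by rewrite ltr0n.
have r0 : 0 <= r%:R :> R by rewrite ler0n.
move: (ksum a r x) (ksum a r.+1 x) (ksum a r.+2 x) (mass x) T0 S0 h
  => T S U m T0 S0 h mm.
have h2 : T * (m * S + r%:R * U) <= T * (m * S + r%:R * (S * (m - r.+1%:R * M))).
  by apply: ler_wpM2l => //; rewrite lerD2l; apply: ler_wpM2l.
have : r.+1%:R * S * S <= r.+1%:R * S * (T * (m - r%:R * M)).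
  have := le_trans mm h2; rewrite expr2 -natr1; lra.
by rewrite ler_pM2l // mulr_gt0.
Qed.

(** The edge sum starts the chain, and j M < mass x keeps all sums positive, as [ratio_up]
    requires. *)
Lemma ratio_growth x M j : (forall v, 0 <= x v) -> 0 < mass x -> 0 <= M ->
  mass x * (mass x - M) <= ksum a 2 x -> j%:R * M < mass x ->
  0 < ksum a j.+1 x /\ ksum a j x * (mass x - j%:R * M) <= ksum a j.+1 x.
Proof.
move=> x0 m0 M0 T2; elim: j => [|j IH] jM.
  by rewrite ksum0 ksum1 mul0r subr0 mul1r.
have [Tp hj] : 0 < ksum a j.+1 x /\ ksum a j x * (mass x - j%:R * M) <= ksum a j.+1 x.
  by apply: IH; apply: le_lt_trans jM; rewrite ler_wpM2r // ler_nat.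
have step : ksum a j.+1 x * (mass x - j.+1%:R * M) <= ksum a j.+2 x.
  case: j jM {IH} Tp hj => [|j] jM Tp hj; first by rewrite ksum1 mul1r.
  apply: ratio_up => //; last exact: ltW.
  case: j jM Tp hj => [|j] jM Tp hj; first by rewrite ksum1.
  by move: (lt_le_trans Tp (ksumS_le j.+2 x0)); rewrite pmulr_rgt0.
by split=> //; apply: lt_le_trans step; rewrite mulr_gt0 // subr_gt0.
Qed.

(** With M = mass x / p the ratios along the chain are (p - j) M, whose product is the falling
    factorial times a power of M. *)
Lemma turan_ksum p r x : (forall v, 0 <= x v) -> (0 < p)%N ->
  mass x ^+ 2 * (p%:R - 1) <= p%:R * ksum a 2 x ->
  (p ^_ r)%:R * mass x ^+ r <= p%:R ^+ r * ksum a r x.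
Proof.
move=> x0 p0 h.
have pR : 0 < p%:R :> R by rewrite ltr0n.
have m0 : 0 <= mass x by apply: sumr_ge0.
have [mx|mx] := eqVneq (mass x) 0.
  rewrite mx; case: r => [|r]; first by rewrite ffactn0 !expr0 !mul1r.
  by rewrite expr0n mulr0 mulr_ge0 ?ksum_ge0 // exprn_ge0 // ltW.
have mpos : 0 < mass x by rewrite lt_neqAle eq_sym mx.
pose M := mass x / p%:R.
have pM : p%:R * M = mass x by rewrite /M mulrC divfK // gt_eqF.
have Mpos : 0 < M by rewrite divr_gt0.
clearbody M; have M0 := ltW Mpos.
have T2 : mass x * (mass x - M) <= ksum a 2 x.
  rewrite -(ler_pM2l pR); apply: le_trans h.
  have -> : p%:R * (mass x * (mass x - M))
            = mass x * (p%:R * mass x) - mass x * (p%:R * M) by ring.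
  by rewrite pM; lra.
rewrite -pM exprMn mulrCA ler_pM2l ?exprn_gt0 //.
elim: r => [|r IH]; first by rewrite ffactn0 ksum0 mulr1.
have [rp|pr] := ltnP r p; last first.
  by rewrite ffact_small ?ltnS // mul0r ksum_ge0.
have [|_ hr] := @ratio_growth x M r x0 mpos M0 T2.
  by rewrite -pM ltr_pM2r // ltr_nat.
apply: le_trans hr.
rewrite ffactnSr natrM exprSr mulrACA ler_pM ?mulr_ge0 ?ler0n ?exprn_ge0 //.
by rewrite natrB ?(ltnW rp) // -pM; lra.
Qed.

(** M = 1 - T_2 makes the first ratio exact; if k M < 1, the chain would give T_(k+1) > 0. *)
Lemma turan_density k x : (forall v, 0 <= x v) -> mass x = 1 ->
  ksum a k.+1 x = 0 -> k%:R * ksum a 2 x <= k%:R - 1.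
Proof.
move=> x0 m Tk; rewrite leNgt; apply/negP => h.
have T2le : ksum a 2 x <= 1 by have := ksumS_le 1 x0; rewrite ksum1 m mul1r.
have := @ratio_growth x (1 - ksum a 2 x) k x0; rewrite m Tk ltxx.
move=> /(_ ltr01); rewrite subr_ge0 T2le mul1r subKr lexx => /(_ isT isT).
case; rewrite ?mulrBr ?mulr1 //; lra.
Qed.

(** Truncated inclusion-exclusion for removing the fraction b v of each weight. The bounds are
    proved together because the step of the upper one uses the lower one in the links, multiplied by
    b v. *)
Lemma bonferroni r x b : (forall v, 0 <= x v) -> (forall v, 0 <= b v <= 1) ->
  ksum a r x - ksum_at a b r x <= ksum a r (fun v => x v * (1 - b v))
  /\ ksum a r (fun v => x v * (1 - b v))
     <= ksum a r x - ksum_at a b r x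
        + ksum_at2 a (fun u v => a u v * b u * b v) r x.
Proof.
move=> + hb; elim: r x => [|r IH] x x0.
  by rewrite !ksum0 /ksum_at /ksum_at2 !mul0r; split; lra.
rewrite ksum_atS // ksum_at2S // !ksumS.
have E : \sum_v x v * (1 - b v) * ksum a r (fun u => x u * (1 - b u) * a v u)
  = \sum_v x v * (1 - b v) * ksum a r (fun u => x u * a v u * (1 - b u)).
  apply: eq_bigr => v _; congr (_ * _); apply: eq_ksum => u; ring.
rewrite E {E}.
have y0 v u : 0 <= x u * a v u by apply: mulr_ge0.
have IHv v := IH (fun u => x u * a v u) (y0 v).
have ym v : ksum a r (fun u => x u * a v u * (1 - b u)) <= ksum a r (fun u => x u * a v u).
  apply: ksum_mono => u; have /andP[b0 b1] := hb u.
  rewrite mulr_ge0 ?subr_ge0 //= ler_piMr //; lra.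
split.
  rewrite -big_split -sumrB /=; apply: ler_sum => v _.
  have [h _] := IHv v; have /andP[b0 _] := hb v.
  have h1 := mulr_ge0 (x0 v) (etrans (subr_ge0 _ _) h).
  have h2 := mulr_ge0 (mulr_ge0 (x0 v) b0) (etrans (subr_ge0 _ _) (ym v)).
  lra.
have -> : r%:R * (\sum_v x v * (\sum_u x u * (a v u * b v * b u)
          * ksum a r.-1 (fun w => x w * a v w * a u w)))
  = \sum_v x v * b v * ksum_at a b r (fun u => x u * a v u).
  rewrite mulr_sumr; apply: eq_bigr => v _; rewrite /ksum_at !mulr_sumr.
  by apply: eq_bigr => u _; ring.
rewrite -!big_split -sumrB -big_split /=; apply: ler_sum => v _.
have [h1 h2] := IHv v; have /andP[b0 _] := hb v.
have h3 := mulr_ge0 (x0 v) (etrans (subr_ge0 _ _) h2).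
have h4 := mulr_ge0 (mulr_ge0 (x0 v) b0) (etrans (subr_ge0 _ _) h1).
lra.
Qed.

End OrderedCliqueSums.

(** * Constrained minima on compact boxes *)

Section FirstOrder.
Variable R : rcfType.
Implicit Types p c : {poly R}.

Lemma poly_incr_right p : 0 < p^`().[0] ->
  exists2 e, 0 < e & forall t, 0 < t < e -> p.[0] < p.[t].
Proof.
move=> p'0; have [e e0 he] := poly_cont 0 p^`() p'0; exists e => // t /andP[t0 te].
have [z] := poly_mvt p t0; rewrite in_itv /= => /andP[z0 zt] eqz.
rewrite -subr_gt0 eqz subr0 mulr_gt0 //.
have /he : `|z - 0| < e by rewrite subr0 gtr0_norm // (lt_trans zt).
by rewrite ltr_norml => /andP[+ _]; lra.
Qed.

(** Strict growth of c keeps the constraint satisfied just after 0 even if c(0) = 0; a negative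
    derivative of p would then contradict minimality at a common small t. *)
Lemma constrained_min_deriv_ge0 p c (e : R) : 0 < e ->
  (forall t, 0 < t < e -> 0 <= c.[t] -> p.[0] <= p.[t]) ->
  0 <= c.[0] -> 0 < c^`().[0] -> 0 <= p^`().[0].
Proof.
move=> e0 hp c0 c'0; rewrite leNgt; apply/negP => p'0.
have [e1 e10 h1] := poly_incr_right c'0.
have [|e2 e20 h2] := @poly_incr_right (- p); first by rewrite derivN hornerN oppr_gt0.
pose t := Num.min e (Num.min e1 e2) / 2.
have m0 : 0 < Num.min e (Num.min e1 e2) by rewrite !lt_min e0 e10.
have tm : t < Num.min e (Num.min e1 e2) by rewrite /t; lra.
have t0 : 0 < t by rewrite divr_gt0.
move: tm; rewrite !lt_min => /and3P[te te1 te2].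
have ct : 0 <= c.[t] by apply: le_trans c0 (ltW _); apply: h1; rewrite t0.
have := hp t; rewrite t0 te => /(_ isT ct).
have := h2 t; rewrite t0 te2 !hornerN => /(_ isT); lra.
Qed.

End FirstOrder.

Section Continuity.
Variables (R : realType) (T : topologicalType).
Implicit Types F G : T -> R.

Lemma cts_cst (k : R) : continuous (fun _ : T => k).
Proof. exact: cst_continuous. Qed.

Lemma ctsD F G : continuous F -> continuous G -> continuous (fun f => F f + G f).
Proof. by move=> cF cG f; apply: (@cvgD _ R^o); [exact: cF|exact: cG]. Qed.

Lemma ctsM F G : continuous F -> continuous G -> continuous (fun f => F f * G f).
Proof. by move=> cF cG f; apply: cvgM; [exact: cF|exact: cG]. Qed.

Lemma ctsB F G : continuous F -> continuous G -> continuous (fun f => F f - G f).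
Proof. by move=> cF cG f; apply: (@cvgB _ R^o); [exact: cF|exact: cG]. Qed.

Lemma ctsX F n : continuous F -> continuous (fun f => F f ^+ n).
Proof.
move=> cF; elim: n => [|n IH]; first exact: cts_cst.
have -> : (fun f => F f ^+ n.+1) = (fun f => F f * F f ^+ n).
  by apply/funext => f; rewrite exprS.
exact: ctsM.
Qed.

Lemma cts_max F G : continuous F -> continuous G ->
  continuous (fun f => Num.max (F f) (G f)).
Proof. by move=> cF cG f; apply: continuous_max; [exact: cF|exact: cG]. Qed.

Lemma cts_sum (J : Type) (r : seq J) (P : pred J) (F : J -> T -> R) :
  (forall j, continuous (F j)) -> continuous (fun f => \sum_(j <- r | P j) F j f).
Proof.
move=> cF; elim: r => [|j r IH].
  have -> : (fun f => \sum_(j <- [::] | P j) F j f) = (fun=> 0).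
    by apply/funext => f; rewrite big_nil.
  exact: cts_cst.
have -> : (fun f => \sum_(j <- j :: r | P j) F j f)
  = (fun f => (if P j then F j f else 0) + \sum_(j <- r | P j) F j f).
  by apply/funext => f; rewrite big_cons; case: (P j); rewrite ?add0r.
by apply: ctsD => //; case: (P j) => //; exact: cts_cst.
Qed.

End Continuity.

Section Minimum.
Variables (R : realType) (I : eqType).

Definition coords := prod_topology (fun _ : I => R).

Lemma cts_coord i : continuous (fun f : coords => f i : R).
Proof. exact: (@proj_continuous I (fun=> R) i). Qed.

Lemma box_min (J : Type) (g : J -> coords -> R) (F : coords -> R) (lo hi : R)
    (f0 : coords) :
  (forall j, continuous (g j)) -> continuous F ->
  let D (f : coords) := (forall i, lo <= f i <= hi) /\ (forall j, 0 <= g j f) in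
  D f0 -> exists2 f, D f & forall f', D f' -> F f <= F f'.
Proof.
move=> cg cF D Df0.
pose A : set coords :=
  ([set f | forall i, `[lo, hi]%classic (f i)] `&`
  \bigcap_(j in setT) (g j @^-1` [set x | 0 <= x]))%classic.
have AD f : A f <-> D f.
  rewrite /A /D /=; split.
    by move=> [h1 h2]; split=> [i|j]; [have := h1 i; rewrite in_itv|exact: h2].
  by move=> [h1 h2]; split=> [i|j _]; [rewrite in_itv; exact: h1|exact: h2].
have cA : compact A.
  apply: compact_closedI.
    exact: (@tychonoff I (fun=> R) (fun=> `[lo, hi]%classic) (fun=> @segment_compact R lo hi)).
  apply: closed_bigI => j _.
  by have /continuous_closedP := cg j; apply; exact: closed_ge.
have [||f fA fmin] := @compact_EVT_min _ R F A _ cA.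
- by exists f0; apply/AD.
- by apply: continuous_subspaceT.
exists f; first by apply/AD; move: fA; rewrite inE.
by move=> f' /AD f'A; apply: fmin; rewrite inE.
Qed.

End Minimum.

(** * Complete multipartite graphs *)

(* The ordered clique sum of the complete multipartite graph with s parts of
   weight L and one further part of weight m - s L, where m is the total mass. *)
Definition multi (R : comNzRingType) (s r : nat) (L m : R) : R :=
  (s ^_ r)%:R * L ^+ r + r%:R * (s ^_ r.-1)%:R * L ^+ r.-1 * (m - s%:R * L).

Section MultiRing.
Variable R : comNzRingType.
Implicit Types L m c : R.

Lemma ffactS_natr s r : (s ^_ r.+1)%:R = (s ^_ r)%:R * (s%:R - r%:R) :> R.
Proof.
rewrite ffactnSr natrM; have [rs|sr] := leqP r s; first by rewrite natrB.
by rewrite ffact_small // !mul0r.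
Qed.

Lemma multiS s q L m : multi s.+1 q.+2 L m =
  (s.+1 * s ^_ q)%:R *
  (q.+2%:R * m * L ^+ q.+1 - (q.+1 * s.+2)%:R * L ^+ q.+2).
Proof.
rewrite /multi ?succnK (ffactSS s q.+1) (ffactSS s q) !(natrM _ s.+1) ffactS_natr (natrM _ q.+1 s.+2).
rewrite -!natr1 !exprS; ring.
Qed.

Lemma multi_pred s q L m : multi s q.+2 L m =
  (s ^_ q)%:R * L ^+ q.+1 * (s%:R - q%:R)
  * ((s%:R - q%:R - 1) * L + q.+2%:R * (m - s%:R * L)).
Proof. by rewrite /multi ?succnK !ffactS_natr -!natr1 !exprS; ring. Qed.

Lemma multi_pred1 s q L m : multi s q.+1 L m =
  (s ^_ q)%:R * L ^+ q * (q.+1%:R * m - (q * s.+1)%:R * L).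
Proof. by rewrite /multi ?succnK !ffactS_natr !natrM -!natr1 !exprS; ring. Qed.

Lemma multi2 s L m :
  multi s 2 L m = 2 * s%:R * L * m - s%:R * (s%:R + 1) * L ^+ 2.
Proof. rewrite multi_pred ffactn0 expr1; ring. Qed.

Lemma multi0 r L m : multi 0 r.+2 L m = 0.
Proof. by rewrite /multi ?succnK !ffact0n !mulr0n !(mul0r, mulr0) addr0. Qed.

Lemma multiZ s r c L m : multi s r (c * L) (c * m) = c ^+ r * multi s r L m.
Proof.
case: r => [|r]; first by rewrite /multi !mul0r !expr0 mul1r.
by rewrite /multi ?succnK !exprMn !exprS; ring.
Qed.

(** At this mass the remainder weighs L and counts as a full part; [local_descent] passes from s + 1
    to s parts here. *)
Lemma multi_junction s r L :
  multi s r.+2 L (s.+1%:R * L) = multi s.+1 r.+2 L (s.+1%:R * L).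
Proof.
by rewrite multiS multi_pred (natrM _ s.+1) (natrM _ r.+1) -!natr1 !exprS; ring.
Qed.

Lemma multi_full s r L : multi s r L (s%:R * L) = (s ^_ r)%:R * L ^+ r.
Proof. by rewrite /multi subrr mulr0 addr0. Qed.

End MultiRing.

Lemma map_multi (R S : comNzRingType) (f : {rmorphism R -> S}) s r (L m : R) :
  f (multi s r L m) = multi s r (f L) (f m).
Proof.
by rewrite /multi rmorphD !rmorphM !rmorphXn rmorphB rmorphM !rmorph_nat.
Qed.

(** The factor 1 - (s+2) l is common to all q, so the derivatives for q and for 0 have ratio C(q+2,
    2) (s^_q) l^q: the multiplier in [stationary]. *)
Lemma deriv_multi (R : comNzRingType) s q (l : {poly R}) :
  deriv (multi s.+1 q.+2 l 1) =
  (s.+1 * s ^_ q * (q.+2 * q.+1))%:R * (l ^+ q * (1 - s.+2%:R * l) * deriv l).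
Proof.
have derivN n (p : {poly R}) : deriv (n%:R * p) = n%:R * deriv p.
  by rewrite !mulr_natl derivMn.
rewrite multiS mulr1 derivN derivB !derivN !deriv_exp !succnK.
by rewrite !natrM exprS; ring.
Qed.

Lemma leq_ffact p s q : (p <= s)%N -> (p ^_ q <= s ^_ q)%N.
Proof.
by move=> ps; elim: q => [//|q IH]; rewrite !ffactnSr leq_mul // leq_sub2r.
Qed.

(** Each factor (p - i) / (p + 1) grows with p. *)
Lemma ffact_ratio p s q : (p <= s)%N ->
  (p ^_ q * s.+1 ^ q <= s ^_ q * p.+1 ^ q)%N.
Proof.
move=> ps; elim: q => [//|q IH]; rewrite !ffactnSr !expnSr.
have h : ((p - q) * s.+1 <= (s - q) * p.+1)%N.
  rewrite !mulnBl; apply: leq_sub; last exact: leq_mul.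
  by rewrite !mulnS [(s * p)%N]mulnC leq_add2r.
by rewrite mulnACA [leqRHS]mulnACA leq_mul.
Qed.

Section MultiOrder.
Variable R : rcfType.
Implicit Types L M m d : R.

Lemma C2_natr q : 2 * 'C(q.+2, 2)%:R = q.+2%:R * q.+1%:R :> R.
Proof.
have := bin_ffact q.+2 2; rewrite ffactnSr ffactn1 => /(congr1 (fun n => n%:R : R)).
by rewrite !natrM subn1 /= => <-; rewrite mulrC.
Qed.

(* d(multi _ r)/dM = C(r,2) p^_q M^q * d(multi _ 2)/dM *)
Lemma multi_mono p q d M1 M2 k : 0 <= M1 -> M1 <= M2 -> d <= p.+2%:R * M1 ->
  (p ^_ q)%:R * M2 ^+ q <= k ->
  multi p.+1 q.+2 M1 d - 'C(q.+2, 2)%:R * k * multi p.+1 2 M1 d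
  <= multi p.+1 q.+2 M2 d - 'C(q.+2, 2)%:R * k * multi p.+1 2 M2 d.
Proof.
move=> M10; rewrite le_eqVlt => /predU1P[->//|M12] dM hk.
pose c : R := (p.+1 * p ^_ q)%:R.
pose f : {poly R} := c *: (q.+2%:R * d *: 'X^(q.+1) - (q.+1 * p.+2)%:R *: 'X^(q.+2))
  - ('C(q.+2, 2)%:R * k * p.+1%:R) *: (2 * d *: 'X - p.+2%:R *: 'X^2).
have fE M : f.[M] = multi p.+1 q.+2 M d - 'C(q.+2, 2)%:R * k * multi p.+1 2 M d.
  rewrite multiS (@multiS _ p 0) /f ffactn0 muln1 mul1n !(hornerD, hornerN, hornerZ, hornerXn, hornerX).
  by rewrite /c expr1; ring.
rewrite -!fE -subr_ge0; have [z] := poly_mvt f M12.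
rewrite in_itv /= => /andP[z1 z2] ->; rewrite mulr_ge0 ?subr_ge0 ?(ltW M12) //.
have -> : (deriv f).[z] = p.+1%:R * (2 * 'C(q.+2, 2)%:R) * (p.+2%:R * z - d) *
    (k - (p ^_ q)%:R * z ^+ q).
  rewrite /f /c !poly.derivE !(hornerMn, hornerD, hornerN, hornerZ, hornerXn, hornerX, hornerC).
  have -> : 'C(q.+2, 2)%:R = q.+2%:R * q.+1%:R / 2 :> R by rewrite -C2_natr; field.
  by rewrite !natrM !succnK !exprS expr0; field.
have z0 : 0 <= z by rewrite (le_trans M10) // ltW.
apply: mulr_ge0; first apply: mulr_ge0; rewrite ?subr_ge0.
- by rewrite mulr_ge0 ?ler0n // mulr_ge0 ?ler0n.
- by apply: le_trans dM _; rewrite ler_wpM2l ?ler0n // ltW.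
- apply: le_trans hk; rewrite ler_wpM2l ?ler0n //.
  by rewrite lerXn2r ?nnegrE ?(ltW z2) // (le_trans z0) // ltW.
Qed.

End MultiOrder.

(** * Clique sums of links *)

Section LocalBound.
Variables (R : rcfType) (V : finType) (a : V -> V -> R).
Implicit Types (x y : V -> R) (L M k : R).

(** Clique density against s parts of weight L; the range of L says that the remaining part weighs
    between 0 and L. *)
Definition dense s r := forall x L, (forall v, 0 <= x v) ->
  s%:R * L <= mass x <= s.+1%:R * L ->
  multi s 2 L (mass x) <= ksum a 2 x -> multi s r L (mass x) <= ksum a r x.

Hypothesis a_w : edge_weights a.

Lemma ratio_chain q j y M : (forall v, 0 <= y v) -> 0 < ksum a q y ->
  ksum a q.+1 y <= ksum a q y * (mass y - q%:R * M) -> (j <= q)%N ->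
  ksum a j.+1 y <= ksum a j y * (mass y - j%:R * M).
Proof.
move=> y0 + + jq; rewrite -(subnKC jq); elim: (q - j)%N => [|i IH].
  by rewrite addn0.
rewrite addnS => Tpos h; apply: IH; last first.
  by apply: ratio_down h => //; apply: ksum_ge0.
have := ksumS_le a_w (j + i) y0; move/(lt_le_trans Tpos).
rewrite lt_neqAle => /andP[ne ge0]; rewrite lt_neqAle ksum_ge0 // andbT.
by apply: contraNneq ne => <-; rewrite mulr0.
Qed.

(** The true ratio T_(q+1) / T_q = d - q Ms bounds T_2 from above and T_(q+2) from below by
    Moon-Moser. The M read off from the prescribed T_(q+1) is at most Ms because k <= T_q, and the
    resulting lower bound increases with Ms, so M may replace it. *)
Lemma local_low s q y L k : (forall v, 0 <= y v) -> (0 < q)%N -> 0 < k -> 0 <= L ->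
  mass y <= s%:R * L -> k <= ksum a q y ->
  ksum a q.+1 y = k * (q.+1%:R * mass y - q%:R * s.+1%:R * L) ->
  k * (multi s q.+2 L (mass y)
       - 'C(q.+2, 2)%:R * ((s ^_ q)%:R * L ^+ q) * multi s 2 L (mass y))
  <= (s ^_ q)%:R * L ^+ q * (ksum a q.+2 y - 'C(q.+2, 2)%:R * k * ksum a 2 y).
Proof.
move=> y0 q0 k0 L0 dL kT TE.
have Tpos : 0 < ksum a q y := lt_le_trans k0 kT.
have T1ge0 := ksum_ge0 a_w q.+1 y0.
pose d := mass y; rewrite -/d in dL TE *.
have d0 : 0 <= d by apply: sumr_ge0.
set K := (s ^_ q)%:R * L ^+ q.
have K0 : 0 <= K by rewrite mulr_ge0 ?ler0n ?exprn_ge0.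
(* Chosen so that the bracket in [TE] is d - q M. *)
pose M := s.+1%:R * L - d.
have brE : q.+1%:R * d - q%:R * s.+1%:R * L = d - q%:R * M.
  by rewrite /M -[q.+1%:R]natr1; ring.
have br0 : 0 <= d - q%:R * M by rewrite -brE -(pmulr_rge0 _ k0) -TE.
pose Ms := (d - ksum a q.+1 y / ksum a q y) / q%:R.
have qR : 0 < q%:R :> R by rewrite ltr0n.
have MsE : ksum a q.+1 y = ksum a q y * (d - q%:R * Ms).
  rewrite /Ms; field; rewrite gt_eqF //= gt_eqF //.
have MMs : M <= Ms.
  have : ksum a q y * (d - q%:R * Ms) <= ksum a q y * (d - q%:R * M).
    by rewrite -MsE TE brE ler_wpM2r.
  by rewrite ler_pM2l // lerD2l lerN2 ler_pM2l.
have T2 : ksum a 2 y <= d * (d - Ms).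
  have := @ratio_chain q 1 y Ms y0 Tpos; rewrite -/d -MsE lexx => /(_ isT q0).
  by rewrite ksum1 mul1r.
have T3 : ksum a q.+1 y * (d - q.+1%:R * Ms) <= ksum a q.+2 y.
  by apply: ratio_up => //; rewrite -/d -MsE.
have T1le : ksum a q.+1 y <= k * d.
  rewrite TE ler_pM2l // -natr1 -subr_ge0.
  have -> : d - ((q%:R + 1) * d - q%:R * s.+1%:R * L) = q%:R * (s.+1%:R * L - d) by ring.
  rewrite mulr_ge0 // subr_ge0 (le_trans dL) // ler_wpM2r // ler_nat //.
set C := 'C(q.+2, 2)%:R.
have CE : C = q.+2%:R * q.+1%:R / 2 by rewrite /C -C2_natr; field.
have C0 : q.+1%:R <= C.
  have : 0 <= q%:R * q.+1%:R :> R by rewrite mulr_ge0.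
  by rewrite CE -[q.+2%:R]natr1 -[q.+1%:R]natr1; lra.
have step1 : ksum a q.+1 y * (d - q.+1%:R * M) - C * k * (d * (d - M))
    <= ksum a q.+2 y - C * k * ksum a 2 y.
  have CkT : C * k * ksum a 2 y <= C * k * (d * (d - Ms)).
    by rewrite ler_wpM2l // mulr_ge0 ?ler0n // ltW.
  have : 0 <= (Ms - M) * (C * (k * d) - q.+1%:R * ksum a q.+1 y).
    by rewrite mulr_ge0 ?subr_ge0 // ler_pM.
  move: T3 CkT; lra.
apply: le_trans (ler_wpM2l K0 step1).
rewrite TE brE multi2 multi_pred -/K.
rewrite -subr_ge0.
(* What is left over is a nonnegative multiple of s L - d. *)
have -> : K * (k * (d - q%:R * M) * (d - q.+1%:R * M) - C * k * (d * (d - M))) -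
  k * ((s ^_ q)%:R * L ^+ q.+1 * (s%:R - q%:R)
      * ((s%:R - q%:R - 1) * L + q.+2%:R * (d - s%:R * L)) -
   C * K * (2 * s%:R * L * d - s%:R * (s%:R + 1) * L ^+ 2))
  = K * k * (s%:R + 1) * L * q%:R * (q%:R + 1) / 2 * (s%:R * L - d).
  by rewrite CE /K /M exprS -[q.+2%:R]natr1 -[q.+1%:R]natr1 -[s.+1%:R]natr1; field.
have k0W := ltW k0.
by rewrite !mulr_ge0 ?invr_ge0 ?subr_ge0 ?addr_ge0 ?ler0n ?exprn_ge0.
Qed.

Lemma multi2_ivt p d M1 M2 T : 0 <= M1 -> M1 <= M2 ->
  multi p 2 M2 d <= T <= multi p 2 M1 d ->
  exists2 M, M1 <= M <= M2 & multi p 2 M d = T :> R.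
Proof.
move=> M10 M12 /andP[h2 h1].
pose f : {poly R} := T%:P - 2 * p%:R * d *: 'X + p%:R * (p%:R + 1) *: 'X^2.
have fE M : f.[M] = T - multi p 2 M d.
  by rewrite multi2 !(hornerD, hornerN, hornerZ, hornerXn, hornerX, hornerC); ring.
have [|M] := @poly_ivt _ f M1 M2 M12; first by rewrite !fE subr_ge0 subr_le0 h1.
move=> M_in /eqP; rewrite fE => /eqP; rewrite subr_eq0 => /eqP ME.
by exists M.
Qed.

(** Let the part weight N grow, and drop one part whenever N reaches d divided by the number of full
    parts. The left-hand side increases along this path by [multi_mono]. Since T_2 of y lies between
    0 and the initial edge sum, the path meets it before the parts run out, and [dense] applies at
    that point. *)
Lemma local_descent s q y L k : (forall v, 0 <= y v) -> (0 < s)%N ->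
  (forall p, (0 < p <= s)%N -> dense p q.+2) ->
  mass y <= s.+1%:R * L -> (s ^_ q)%:R * L ^+ q <= k ->
  forall p N, (0 < p <= s)%N -> 0 <= N ->
  p%:R * N <= mass y <= p.+1%:R * N -> ksum a 2 y <= multi p 2 N (mass y) ->
  multi p q.+2 N (mass y) - 'C(q.+2, 2)%:R * k * multi p 2 N (mass y)
  <= ksum a q.+2 y - 'C(q.+2, 2)%:R * k * ksum a 2 y.
Proof.
move=> y0 s0 dens dL Lk.
pose d := mass y; rewrite -/d in dL *.
have L0 : 0 <= L.
  have : 0 <= d by apply: sumr_ge0.
  by move/le_trans => /(_ _ dL); rewrite pmulr_rge0 ?ltr0n.
elim=> [//|p IH] N /andP[_ ps] N0 /andP[pN dN] TN.
have pR : 0 < p.+1%:R :> R by rewrite ltr0n.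
pose N' := d / p.+1%:R.
have N'E : p.+1%:R * N' = d by rewrite /N' mulrC divfK ?gt_eqF.
have NN' : N <= N' by rewrite -(ler_pM2l pR) N'E.
(* The slope condition for s parts implies it for fewer, by [ffact_ratio] and (p+1) M <= d <= (s+1)
   L. *)
have hk M : 0 <= M -> M <= N' -> (p ^_ q)%:R * M ^+ q <= k.
  move=> M0 MN'; apply: le_trans Lk.
  rewrite -(ler_pM2l (exprn_gt0 q pR)).
  have h1 : (p.+1%:R * M) ^+ q <= (s.+1%:R * L) ^+ q.
    rewrite lerXn2r ?nnegrE ?mulr_ge0 // (le_trans _ dL) //.
    by rewrite -N'E ler_pM2l.
  have h2 : (p ^_ q)%:R * s.+1%:R ^+ q <= (s ^_ q)%:R * p.+1%:R ^+ q :> R.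
    by rewrite -!natrX -!natrM ler_nat ffact_ratio // ltnW.
  have -> : p.+1%:R ^+ q * ((p ^_ q)%:R * M ^+ q) = (p ^_ q)%:R * (p.+1%:R * M) ^+ q.
    by rewrite exprMn mulrCA.
  apply: le_trans (ler_wpM2l (ler0n _ _) h1) _.
  rewrite exprMn mulrA.
  apply: le_trans (ler_wpM2r (exprn_ge0 q L0) h2) _.
  by rewrite le_eqVlt; apply/orP; left; apply/eqP; ring.
have [TN'|TN'] := leP (multi p.+1 2 N' d) (ksum a 2 y).
  have [M /andP[NM MN'] ME] := multi2_ivt N0 NN' (introT andP (conj TN' TN)).
  have M0 := le_trans N0 NM.
  apply: le_trans (multi_mono (k := k) N0 NM dN (hk M M0 MN')) _.
  rewrite ME lerD2r; apply: dens => //; last by rewrite ME.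
  rewrite -/d -{1}N'E ler_pM2l // MN' /=.
  by apply: le_trans dN _; rewrite ler_wpM2l.
have N'0 := le_trans N0 NN'.
apply: le_trans (multi_mono (k := k) N0 NN' dN (hk N' N'0 (lexx _))) _.
have J r : multi p.+1 r.+2 N' d = multi p r.+2 N' d.
  by rewrite -N'E multi_junction.
rewrite !J; rewrite J in TN'.
case: p IH ps pN dN TN pR N' N'E NN' hk J N'0 TN' => [|p] IH ps pN dN TN pR N' N'E NN' hk J N'0 TN'.
  by move: TN'; rewrite multi0 ltNge ksum_ge0.
have ps' : (0 < p.+1 <= s)%N by rewrite (ltnW ps).
apply: IH => //; last exact: ltW.
by rewrite N'E lexx andbT -N'E ler_wpM2r // ler_nat.
Qed.

(** If y had more edges than the comparison graph, density for q+1 would force T_(q+1) to be at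
    least K times the bracket in [TE], against k < K. So the descent applies, with K as its
    constant, and the surplus (K - k) T_(q+2) is nonnegative. *)
Lemma local_high s q y L k : (forall v, 0 <= y v) -> (0 < q <= s)%N ->
  dense s q.+1 -> (forall p, (0 < p <= s)%N -> dense p q.+2) ->
  0 < k -> 0 < L -> k < (s ^_ q)%:R * L ^+ q ->
  s%:R * L < mass y <= s.+1%:R * L ->
  ksum a q.+1 y = k * (q.+1%:R * mass y - q%:R * s.+1%:R * L) ->
  k * (multi s q.+2 L (mass y)
       - 'C(q.+2, 2)%:R * ((s ^_ q)%:R * L ^+ q) * multi s 2 L (mass y))
  <= (s ^_ q)%:R * L ^+ q * (ksum a q.+2 y - 'C(q.+2, 2)%:R * k * ksum a 2 y).
Proof.
move=> y0 /andP[q0 qs] dens1 dens2 k0 L0 kK /andP[sd ds] TE.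
have T1ge0 := ksum_ge0 a_w q.+1 y0.
have s0 : (0 < s)%N := leq_trans q0 qs.
set K := (s ^_ q)%:R * L ^+ q in kK *.
have K0 := lt_trans k0 kK.
have T2le : ksum a 2 y <= multi s 2 L (mass y).
  rewrite leNgt; apply/negP => /ltW T2.
  have := dens1 y L y0 _ T2; rewrite ltW // => /(_ ds).
  rewrite multi_pred1 -/K natrM TE.
  have qsR : q%:R <= s%:R :> R by rewrite ler_nat.
  have br0 : 0 < q.+1%:R * mass y - q%:R * s.+1%:R * L.
    rewrite subr_gt0; apply: le_lt_trans (_ : q.+1%:R * (s%:R * L) < _); last first.
      by rewrite ltr_pM2l ?ltr0n.
    rewrite mulrA ler_pM2r // -!natr1; lra.
  by rewrite ler_pM2r // leNgt kK.
have := @local_descent s q y L K y0 s0 dens2 ds (lexx _) s L.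
rewrite s0 leqnn (ltW L0) (ltW sd) ds => /(_ isT isT isT T2le) main.
have := ler_wpM2l (ltW k0) main.
have : 0 <= (K - k) * ksum a q.+2 y by rewrite mulr_ge0 ?ksum_ge0 // subr_ge0 ltW.
lra.
Qed.

End LocalBound.

Lemma cts_ksum (R : realType) (T : topologicalType) (V : finType)
    (A : V -> V -> T -> R) r (X : V -> T -> R) :
  (forall u v, continuous (A u v)) -> (forall v, continuous (X v)) ->
  continuous (fun f => ksum (fun u v => A u v f) r (fun v => X v f)).
Proof.
move=> cA; elim: r X => [|r IH] X cX; first exact: cts_cst.
apply: cts_sum => v; apply: ctsM => //.
by apply: (IH (fun u f => X u f * A v u f)) => u; exact: ctsM.
Qed.

(** * Minimisers of the clique sum *)

Section Segment.
Variables (R : comNzRingType) (V : finType).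
Variables (a a' : V -> V -> R) (x x' : V -> R).
Hypotheses (a_sym : forall u v, a u v = a v u) (a'_sym : forall u v, a' u v = a' v u).

Definition seg_ksum r : {poly R} :=
  ksum (fun u v => (a u v)%:P + (a' u v - a u v)%:P * 'X) r
       (fun v => (x v)%:P + (x' v - x v)%:P * 'X).

Lemma seg_ksum_at r t : (seg_ksum r).[t] =
  ksum (fun u v => a u v + t * (a' u v - a u v)) r (fun v => x v + t * (x' v - x v)).
Proof.
have -> : (seg_ksum r).[t] = horner_eval t (seg_ksum r) by [].
rewrite map_ksum; have E u w : horner_eval t (u%:P + w%:P * 'X) = u + t * w.
  by rewrite /horner_eval /= !hornerE mulrC.
rewrite -[LHS]/(ksum _ _ _); congr (ksum _ _ _).
  by apply/funext => u; apply/funext => v; exact: E.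
by apply/funext => u; exact: E.
Qed.

Lemma seg_ksum_at0 r : (seg_ksum r).[0] = ksum a r x.
Proof.
rewrite seg_ksum_at; congr (ksum _ _ _).
  by apply/funext => u; apply/funext => v; rewrite mul0r addr0.
by apply/funext => u; rewrite mul0r addr0.
Qed.

(* The first term moves the weights, the second one the edge weights. *)
Definition dksum r : R :=
  r%:R * (\sum_v (x' v - x v) * ksum a r.-1 (fun u => x u * a v u))
  + ksum_at2 a (fun u v => a' u v - a u v) r x.

Lemma seg_ksum_deriv0 r : (seg_ksum r)^`().[0] = dksum r.
Proof.
rewrite /seg_ksum deriv_ksum; last by move=> u v; rewrite a_sym a'_sym.
pose phi : {rmorphism {poly R} -> R} := horner_eval (0 : R).
have E u w : phi (u%:P + w%:P * 'X) = u.
  by rewrite /= /horner_eval !(hornerD, hornerM, hornerC, hornerX) mulr0 addr0.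
have E' u w : phi (deriv (u%:P + w%:P * 'X)) = w.
  by rewrite /= /horner_eval derivD derivM !derivC derivX mulr1 mul0r !add0r hornerC.
rewrite -[_.[0]]/(phi _) /dksum /ksum_at2 rmorphD !rmorphM !rmorph_nat.
have K j (y : V -> {poly R}) :
    phi (ksum (fun u v => (a u v)%:P + (a' u v - a u v)%:P * 'X) j y)
  = ksum a j (fun v => phi (y v)).
  rewrite map_ksum; congr (ksum _ _ _).
  by apply/funext => u; apply/funext => v; rewrite E.
congr (_ * _ + _ * _); rewrite rmorph_sum; apply: eq_bigr => v _.
  rewrite rmorphM E' K; congr (_ * _); apply: eq_ksum => u.
  by rewrite rmorphM !E.
rewrite rmorphM E; congr (_ * _); rewrite rmorph_sum; apply: eq_bigr => u _.
rewrite !rmorphM E E' K; congr (_ * _); apply: eq_ksum => w.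
by rewrite !rmorphM !E.
Qed.

End Segment.

Section Minimiser.
Variables (R : realType) (V : finType) (s q : nat).
Implicit Types (a : V -> V -> R) (x : V -> R) (L : R).

Definition feasible a x L :=
  [/\ edge_weights a, (forall v, 0 <= x v), mass x = 1,
      s.+1%:R * L <= 1 <= s.+2%:R * L & multi s.+1 2 L 1 <= ksum a 2 x].

Definition gap a x L := ksum a q.+2 x - multi s.+1 q.+2 L 1.

Lemma exists_min_gap a1 x1 L1 : feasible a1 x1 L1 ->
  exists a x L, feasible a x L /\
    forall a' x' L', feasible a' x' L' -> gap a x L <= gap a' x' L'.
Proof.
move=> [a1_w x1_ge0 m1 L1_in T1].
pose I := (V + V * V + unit)%type.
pose X (v : V) (f : coords R I) : R := f (inl (inl v)).
(* Averaging builds symmetry in, so the feasible set is cut out of a box by continuous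
   inequalities. *)
pose A (u v : V) (f : coords R I) : R :=
  (f (inl (inr (u, v))) + f (inl (inr (v, u)))) * 2^-1.
pose LL (f : coords R I) : R := f (inr tt).
have cX v : continuous (X v) by exact: cts_coord.
have cA u v : continuous (A u v).
  by apply: ctsM; [apply: ctsD; exact: cts_coord|exact: cts_cst].
have cL : continuous LL by exact: cts_coord.
have cm : continuous (fun f => mass (fun v => X v f)) by exact: cts_sum.
have cK r : continuous (fun f => ksum (fun u v => A u v f) r (fun v => X v f)).
  exact: cts_ksum.
have cM k r : continuous (fun f => multi k r (LL f) 1).
  rewrite /multi; apply: ctsD.
    by apply: ctsM; [exact: cts_cst|exact: ctsX].
  apply: ctsM; first by apply: ctsM; [exact: cts_cst|exact: ctsX].
  by apply: ctsB; [exact: cts_cst|apply: ctsM => //; exact: cts_cst].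
pose g (j : nat) (f : coords R I) : R := match j with
  | 0 => mass (fun v => X v f) - 1
  | 1 => 1 - mass (fun v => X v f)
  | 2 => 1 - s.+1%:R * LL f
  | 3 => s.+2%:R * LL f - 1
  | _ => ksum (fun u v => A u v f) 2 (fun v => X v f) - multi s.+1 2 (LL f) 1
  end.
have cg j : continuous (g j).
  have c1 := @cts_cst R (coords R I).
  by case: j => [|[|[|[|j]]]]; apply: ctsB => //; apply: ctsM.
pose F (f : coords R I) := gap (fun u v => A u v f) (fun v => X v f) (LL f).
have cF : continuous F by exact: ctsB.
pose mk a x L : coords R I := fun i => match i with
  | inl (inl v) => x v | inl (inr uv) => a uv.1 uv.2 | inr _ => L end.
have mkA a x L : edge_weights a -> (fun u v => A u v (mk a x L)) = a.
  move=> [a_sym _]; apply/funext => u; apply/funext => v.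
  by rewrite /A /= (a_sym v u); field.
have mkD a x L : feasible a x L ->
    (forall i, 0 <= mk a x L i <= 1) /\ (forall j, 0 <= g j (mk a x L)).
  move=> [a_w x0 m Lin T]; split.
    move=> [[v|[u v]]|[]] /=.
    - rewrite x0 -m /mass (bigD1 v) //= lerDl; exact: sumr_ge0.
    - by case: a_w => _.
    - have /andP[h1 h2] := Lin; apply/andP; split.
        by rewrite -(@pmulr_rge0 _ s.+2%:R) ?ltr0n // (le_trans _ h2).
      rewrite -(@ler_pM2l _ s.+1%:R) ?ltr0n // mulr1 (le_trans h1) //.
      by rewrite ler1n.
  have /andP[h1 h2] := Lin.
  move=> [|[|[|[|j]]]]; rewrite /g subr_ge0 ?mkA //; first by rewrite -m.
  by rewrite -m.
have Dfeas f : (forall i, 0 <= f i <= 1) -> (forall j, 0 <= g j f) ->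
    feasible (fun u v => A u v f) (fun v => X v f) (LL f).
  move=> f01 gf; split.
  - split=> [u v|u v]; first by rewrite /A addrC.
    have := f01 (inl (inr (u, v))); have := f01 (inl (inr (v, u))).
    by rewrite /A => /andP[? ?] /andP[? ?]; apply/andP; split; lra.
  - by move=> v; case/andP: (f01 (inl (inl v))).
  - by have := gf 0%N; have := gf 1%N; rewrite /= !subr_ge0 => ? ?; apply/le_anti/andP.
  - by have := gf 2%N; have := gf 3%N; rewrite /= !subr_ge0 => -> ->.
  - by have := gf 4%N; rewrite /= subr_ge0.
have [f [f01 gf] fmin] := box_min cg cF (mkD a1 x1 L1 (And5 a1_w x1_ge0 m1 L1_in T1)).
exists (fun u v => A u v f), (fun v => X v f), (LL f); split; first exact: Dfeas.
move=> a' x' L' h; have := fmin _ (mkD _ _ _ h); rewrite /F mkA //.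
by case: h.
Qed.

(** At both ends of the range of L the comparison graph has equal parts, and Turan's bound
    applies. *)
Lemma gap_ge0_boundary a x L : feasible a x L ->
  s.+1%:R * L = 1 \/ s.+2%:R * L = 1 -> 0 <= gap a x L.
Proof.
move=> [a_w x0 m _ T2] bd; rewrite /gap subr_ge0.
have [p [p0 pL E]] : exists p, [/\ (0 < p)%N, p%:R * L = 1
    & forall r, multi s.+1 r.+2 L 1 = (p ^_ r.+2)%:R * L ^+ r.+2].
  case: bd => bd; [exists s.+1|exists s.+2]; split=> // r; rewrite -{1}bd.
    exact: multi_full.
  by rewrite multi_junction multi_full.
have pR : 0 < p%:R :> R by rewrite ltr0n.
have L0 : 0 < L by rewrite -(pmulr_rgt0 _ pR) pL.
have T : (p ^_ q.+2)%:R * mass x ^+ q.+2 <= p%:R ^+ q.+2 * ksum a q.+2 x.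
  apply: turan_ksum => //; move: T2; rewrite m expr1n mul1r -(ler_pM2l pR).
  apply: le_trans; rewrite E ffactS_natr ffactn1.
  have -> : p%:R * (p%:R * (p%:R - 1) * L ^+ 2) = (p%:R * L) ^+ 2 * (p%:R - 1) by ring.
  by rewrite pL expr1n mul1r.
rewrite E; move: (ler_wpM2r (exprn_ge0 q.+2 (ltW L0)) T).
rewrite m expr1n mulr1 mulrAC -exprMn pL expr1n mul1r.
by apply.
Qed.

(** L moves at the speed t for which the constraint grows at rate exactly ep. Since L is interior,
    kap is nonzero and the moved L stays in range. *)
Lemma stationary a x L x' a' : feasible a x L ->
  (forall b y M, feasible b y M -> gap a x L <= gap b y M) ->
  s.+1%:R * L < 1 < s.+2%:R * L ->
  (forall v, 0 <= x' v) -> mass x' = 1 -> edge_weights a' ->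
  'C(q.+2, 2)%:R * ((s ^_ q)%:R * L ^+ q) * dksum a a' x x' 2
  <= dksum a a' x x' q.+2.
Proof.
move=> [a_w x0 m _ T2] amin /andP[sL Ls] x'0 m' a'_w.
have [a_sym a01] := a_w; have [a'_sym a'01] := a'_w.
have L0 : 0 < L by rewrite -(@pmulr_rgt0 _ s.+2%:R) ?ltr0n // (lt_trans ltr01).
set Lam := _ * (_ * _).
have Lam0 : 0 <= Lam by rewrite !mulr_ge0 ?ler0n ?exprn_ge0 // ltW.
pose kap := 1 - s.+2%:R * L.
have kap0 : kap < 0 by rewrite subr_lt0.
have sR : 0 < s.+1%:R :> R by rewrite ltr0n.
have s2R : 0 < s.+2%:R :> R by rewrite ltr0n.
apply/ler_addgt0Pr => eps eps0.
pose ep := eps / (Lam + 1).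
have ep0 : 0 < ep by rewrite divr_gt0 // ltr_wpDl.
have epE : Lam * ep <= eps.
  by rewrite /ep mulrA ler_pdivrMr ?ltr_wpDl // mulrC ler_pM2l // lerDl.
pose t := (dksum a a' x x' 2 - ep) / (2 * s.+1%:R * kap).
pose l : {poly R} := L%:P + t%:P * 'X.
pose M r : {poly R} := multi s.+1 r l 1.
have lE z : l.[z] = L + t * z by rewrite /l hornerD hornerM !hornerC hornerX.
have ME r z : (M r).[z] = multi s.+1 r (L + t * z) 1.
  pose phi : {rmorphism {poly R} -> R} := horner_eval z.
  rewrite -[_.[z]]/(phi _) map_multi rmorph1; congr (multi _ _ _ _).
  exact: lE.
have dM r : (deriv (M r.+2)).[0] =
    (s.+1 * s ^_ r * (r.+2 * r.+1))%:R * (L ^+ r * kap * t).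
  rewrite deriv_multi -polyC_natr !(hornerM, hornerC) hornerD hornerN hornerM -polyC_natr.
  rewrite !hornerC horner_exp lE /l derivD derivM !derivC derivX mulr1 mul0r !add0r hornerC.
  by rewrite mulr0 addr0.
pose p := seg_ksum a a' x x' q.+2 - M q.+2.
pose c := seg_ksum a a' x x' 2 - M 2.
pose w := Num.min (1 - s.+1%:R * L) (s.+2%:R * L - 1).
have w0 : 0 < w by rewrite lt_min !subr_gt0 sL Ls.
pose e := Num.min 1 (w / (s.+2%:R * (`|t| + 1))).
have t1 : 0 < `|t| + 1 by rewrite ltr_wpDl.
have e0 : 0 < e by rewrite lt_min ltr01 divr_gt0 // mulr_gt0.
have pE z : p.[z] = gap (fun u v => a u v + z * (a' u v - a u v))
    (fun v => x v + z * (x' v - x v)) (L + t * z).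
  by rewrite /p hornerD hornerN seg_ksum_at ME.
have p0E : p.[0] = gap a x L.
  by rewrite /p hornerD hornerN seg_ksum_at0 ME mulr0 addr0.
have tE : 2 * s.+1%:R * kap * t = dksum a a' x x' 2 - ep.
  by rewrite /t mulrC divfK // !mulf_neq0 ?pnatr_eq0 // lt_eqF.
have dcE : (deriv c).[0] = ep.
  rewrite /c derivB hornerD hornerN seg_ksum_deriv0 // dM.
  have -> : (s.+1 * s ^_ 0 * (2 * 1))%:R * (L ^+ 0 * kap * t) = dksum a a' x x' 2 - ep.
    by rewrite -tE ffactn0 !natrM; ring.
  by rewrite opprB addrC subrK.
have dpE : (deriv p).[0] = dksum a a' x x' q.+2 - Lam * (dksum a a' x x' 2 - ep).
  rewrite /p derivB hornerD hornerN seg_ksum_deriv0 // dM -tE /Lam.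
  rewrite !natrM -[q.+2%:R * q.+1%:R]C2_natr; ring.
have : 0 <= (deriv p).[0].
  apply: (@constrained_min_deriv_ge0 R p c e e0) => [z /andP[z0 ze] cz||]; last 2 first.
  - rewrite /c hornerD hornerN seg_ksum_at0 ME mulr0 addr0 subr_ge0 //.
  - by rewrite dcE.
  rewrite p0E pE; apply: amin.
  move: ze; rewrite lt_min ltr_pdivlMr ?mulr_gt0 // => /andP[z1 zw].
  have cvx (u v : R) : 0 <= u -> 0 <= v -> 0 <= u + z * (v - u).
    move=> u0 v0; have -> : u + z * (v - u) = (1 - z) * u + z * v by ring.
    by rewrite addr_ge0 // mulr_ge0 ?subr_ge0 // ltW.
  have tz : `|t * z| * s.+2%:R <= w.
    rewrite normrM (gtr0_norm z0); apply: le_trans (ltW zw).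
    have : 0 <= z * s.+2%:R by rewrite mulr_ge0 // ltW.
    lra.
  have tzn : `|t * z| * s.+1%:R <= w.
    by apply: le_trans tz; rewrite ler_wpM2l // ler_nat.
  have wle : w <= 1 - s.+1%:R * L /\ w <= s.+2%:R * L - 1.
    by rewrite /w !ge_min !lexx orbT.
  split.
  - split=> u v; first by rewrite a_sym a'_sym.
    have /andP[h1 h2] := a01 u v; have /andP[h3 h4] := a'01 u v.
    rewrite cvx //= -subr_ge0.
    have -> : 1 - (a u v + z * (a' u v - a u v))
            = (1 - a u v) + z * ((1 - a' u v) - (1 - a u v)) by ring.
    by rewrite cvx ?subr_ge0.
  - by move=> v; apply: cvx.
  - rewrite /mass big_split -mulr_sumr sumrB /=.
    rewrite -/(mass x) -/(mass x') m m'; ring.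
  - case: wle => w1 w2; apply/andP; split.
      have := ler_wpM2r (ltW sR) (ler_norm (t * z)); lra.
    have := ler_wpM2r (ltW s2R) (ler_norm (- (t * z))); rewrite normrN; lra.
  - move: cz; rewrite /c hornerD hornerN seg_ksum_at ME subr_ge0 //.
rewrite dpE; lra.
Qed.

End Minimiser.

(* Interpolating [a] by [cross v] towards 0 or 1 changes it only at pairs containing
   [v], so that the stationarity condition becomes one about the link of [v]. *)
Definition cross (R : realFieldType) (V : finType) (v u w : V) : R :=
  ((u == v)%:R + (w == v)%:R) / 2.

Lemma crossC (R : realFieldType) (V : finType) (v u w : V) :
  cross R v u w = cross R v w u.
Proof. by rewrite /cross addrC. Qed.

Lemma cross01 (R : realFieldType) (V : finType) (v u w : V) :
  0 <= cross R v u w <= 1.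
Proof.
rewrite /cross; case: (u == v); case: (w == v); rewrite ?mulr1n ?mulr0n;
  by apply/andP; split; lra.
Qed.

Lemma sum_cross (R : realFieldType) (V : finType) (x : V -> R) v (g : V -> V -> R) :
  (forall u w, g u w = g w u) ->
  \sum_u x u * \sum_w x w * (cross R v u w * g u w) = x v * \sum_w x w * g v w.
Proof.
move=> g_sym; rewrite /cross.
have E (f : V -> R) : \sum_u (u == v)%:R * f u = f v.
  rewrite (bigD1 v) //= eqxx mul1r big1 ?addr0 // => u /negPf->.
  by rewrite mul0r.
transitivity ((\sum_u (u == v)%:R * (x u * \sum_w x w * g u w)
   + \sum_w (w == v)%:R * (x w * \sum_u x u * g w u)) / 2); last first.
  by rewrite !E; field.
under [X in _ = (_ + X) / 2]eq_bigr do rewrite !mulr_sumr.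
rewrite [X in _ = (_ + X) / 2]exchange_big /= -big_split /= mulr_suml.
apply: eq_bigr => u _; rewrite !mulr_sumr -big_split /= mulr_suml.
by apply: eq_bigr => w _; rewrite (g_sym w u); field.
Qed.

Lemma weighted_eq (R : realFieldType) (V : finType) (x f : V -> R) m :
  (forall v, 0 <= x v) -> mass x = 1 -> (forall v, m <= f v) ->
  \sum_v x v * f v = m -> forall v, 0 < x v -> f v = m.
Proof.
move=> x0 x1 mf fm v xv.
have : \sum_v x v * (f v - m) = 0.
  under eq_bigr do rewrite mulrBr.
  by rewrite sumrB fm -mulr_suml -/(mass x) x1 mul1r subrr.
move/psumr_eq0P => /(_ (fun u _ => mulr_ge0 (x0 u) (etrans (subr_ge0 _ _) (mf u)))).
move=> /(_ v isT)/eqP; rewrite mulf_eq0 gt_eqF //= subr_eq0; exact: eqP.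
Qed.

(** * Contradiction at a minimiser with negative gap *)

Section AtMinimum.
Variables (R : realType) (V : finType) (s q : nat).
Variables (a : V -> V -> R) (x : V -> R) (L : R).
Hypotheses (qs : (0 < q <= s)%N) (fx : feasible s a x L).
Hypothesis amin : forall (b : V -> V -> R) (y : V -> R) (M : R),
  feasible s b y M -> gap s q a x L <= gap s q b y M.
Hypothesis gap_lt0 : gap s q a x L < 0.
Hypothesis dense1 : forall p, (0 < p <= s.+1)%N -> dense a p q.+1.
Hypothesis dense2 : forall p, (0 < p <= s)%N -> dense a p q.+2.

Local Notation T r := (ksum a r x).
Local Notation nb v := (fun u => x u * a v u).
Local Notation C := ('C(q.+2, 2)%:R : R).

(* [vertex]: on the support of x the link sum is q.+1 * lam * deg - cc; L' is the part
   size of the multipartite graph with the same constant term. *)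
Let lam : R := (s ^_ q)%:R * L ^+ q.
Let cc : R := q.+1%:R * lam * T 2 - T q.+2.
Let L' : R := cc / (q%:R * lam * s.+1%:R).
Let K : R := (s ^_ q)%:R * L' ^+ q.
Let deg v := mass (nb v).

Let a_w : edge_weights a. Proof. by case: fx. Qed.
Let a_sym u v : a u v = a v u. Proof. by case: a_w. Qed.
Let a_ge0 u v : 0 <= a u v. Proof. by case: a_w => _ /(_ u v)/andP[]. Qed.
Let a_le1 u v : a u v <= 1. Proof. by case: a_w => _ /(_ u v)/andP[]. Qed.
Let x_ge0 v : 0 <= x v. Proof. by case: fx. Qed.
Let x1 : mass x = 1. Proof. by case: fx. Qed.
Let T2_ge : multi s.+1 2 L 1 <= T 2. Proof. by case: fx. Qed.
Let q_gt0 : (0 < q)%N. Proof. by case/andP: qs. Qed.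
Let qR : 0 < q%:R :> R. Proof. by rewrite ltr0n. Qed.
Let sR : 0 < s.+1%:R :> R. Proof. by rewrite ltr0n. Qed.
Let s2R : 0 < s.+2%:R :> R. Proof. by rewrite ltr0n. Qed.

Let L_bounds : s.+1%:R * L < 1 < s.+2%:R * L.
Proof.
have [_ _ _ /andP[h1 h2] _] := fx; rewrite !lt_neqAle h1 h2 !andbT.
apply/andP; split; apply/eqP => E; move: gap_lt0; rewrite ltNge gap_ge0_boundary //.
  by left.
by right.
Qed.

Let L_gt0 : 0 < L.
Proof. by case/andP: L_bounds => _ h; rewrite -(pmulr_rgt0 _ s2R) (lt_trans ltr01). Qed.

Let ff_gt0 : 0 < (s ^_ q)%:R :> R.
Proof. by rewrite ltr0n ffact_gt0; case/andP: qs. Qed.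

Let lam_gt0 : 0 < lam. Proof. by rewrite mulr_gt0 // exprn_gt0. Qed.

Let C2 : 2 * C = q.+2%:R * q.+1%:R. Proof. exact: C2_natr. Qed.
Let C_gt0 : 0 < C. Proof. by rewrite ltr0n bin_gt0. Qed.

Let nb_ge0 v u : 0 <= x u * a v u. Proof. exact: mulr_ge0. Qed.

(** Moving the weight towards one vertex u gives an inequality for every u; its average over x is an
    equality, so it is tight on the support. *)
Let vertex v : 0 < x v -> ksum a q.+1 (nb v) = q.+1%:R * lam * deg v - cc.
Proof.
move=> xv; suff : ksum a q.+1 (nb v) - q.+1%:R * lam * deg v = T q.+2 - q.+1%:R * lam * T 2.
  by rewrite /cc => /eqP; rewrite subr_eq => /eqP->; ring.
apply: (@weighted_eq _ _ x
  (fun v => ksum a q.+1 (nb v) - q.+1%:R * lam * deg v)) xv => // [u|]; last first.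
  under eq_bigr do rewrite mulrBr mulrCA.
  by rewrite sumrB -mulr_sumr ksum2.
have := stationary fx amin L_bounds (x' := fun w => (w == u)%:R) (a' := a).
move=> /(_ (fun=> ler0n _ _)) /(_ _ a_w).
have D (f : V -> R) : \sum_w ((w == u)%:R - x w) * f w = f u - \sum_w x w * f w.
  under eq_bigr do rewrite mulrBl.
  rewrite sumrB (bigD1 u) //= eqxx mul1r big1 ?addr0 // => w /negPf->.
  by rewrite mul0r.
have E r : dksum a a x (fun w => (w == u)%:R) r
  = r%:R * (ksum a r.-1 (nb u) - \sum_w x w * ksum a r.-1 (nb w)).
  rewrite /dksum D /ksum_at2 [X in _ + _ * X]big1 ?mulr0 ?addr0 // => w _.
  by rewrite big1 ?mulr0 // => z _; rewrite subrr mulr0 mul0r.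
have -> : mass (fun w => (w == u)%:R) = 1 :> R.
  by rewrite /mass (bigD1 u) //= eqxx big1 ?addr0 // => w /negPf->.
move=> /(_ erefl); rewrite !E !succnK -!ksumS ksum1 -/(deg u) -/lam.
have -> : C * lam * (2 * (deg u - T 2)) = q.+2%:R * (q.+1%:R * lam * (deg u - T 2)).
  by rewrite !mulrA -C2; ring.
rewrite ler_pM2l ?ltr0n //; lra.
Qed.

Let edge a' : edge_weights a' ->
  0 <= \sum_v x v * \sum_u x u * ((a' v u - a v u)
       * (ksum a q (fun w => x w * a v w * a u w) - lam)).
Proof.
move=> a'_w; have := stationary fx amin L_bounds x_ge0 x1 a'_w.
have E r : dksum a a' x x r = ksum_at2 a (fun u v => a' u v - a u v) r x.
  by rewrite /dksum big1 ?mulr0 ?add0r // => v _; rewrite subrr mul0r.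
rewrite !E /ksum_at2 -/lam !succnK binn mul1r -mulrA ler_pM2l //.
rewrite -subr_ge0 mulr_sumr -sumrB.
move=> h; apply: le_trans h _; rewrite le_eqVlt; apply/orP; left; apply/eqP.
apply: eq_bigr => v _; rewrite [lam * _]mulrCA -mulrBr; congr (_ * _).
by rewrite mulr_sumr -sumrB; apply: eq_bigr => u _; rewrite ksum0 mulr1 [lam * _]mulrC -mulrBr mulrA.
Qed.

Let codeg_sym u w : ksum a q (fun z => x z * a u z * a w z)
  = ksum a q (fun z => x z * a w z * a u z).
Proof. by apply: eq_ksum => z; rewrite mulrAC. Qed.

(** Lowering the edge weights at v shows that the T_(q+1) sum of its link is at most lam * deg v;
    [vertex] turns this into a bound on the degree. *)
Let deg_ub v : 0 < x v -> deg v <= s.+1%:R * L'.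
Proof.
move=> xv.
pose th u w := cross R v u w.
have th01 u w : 0 <= th u w <= 1 := cross01 R v u w.
have a'_w : edge_weights (fun u w => a u w * (1 - th u w)).
  split=> u w; first by rewrite a_sym /th crossC.
  have /andP[t0 t1] := th01 u w; rewrite mulr_ge0 ?subr_ge0 //=.
  by rewrite mulr_ile1 ?subr_ge0 // lerBlDr lerDl.
have := edge a'_w.
pose g u w : R := - a u w * (ksum a q (fun z => x z * a u z * a w z) - lam).
have g_sym u w : g u w = g w u by rewrite /g a_sym codeg_sym.
under eq_bigr => u _.
  under eq_bigr => w _.
    have -> : (a u w * (1 - th u w) - a u w)
        * (ksum a q (fun z => x z * a u z * a w z) - lam) = th u w * g u w.
      by rewrite /g; lra.
    over.
  over.
rewrite sum_cross // pmulr_rge0 // => h.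
have h2 : ksum a q.+1 (nb v) <= lam * deg v.
  rewrite ksumS /deg /mass mulr_sumr -subr_ge0 -sumrB; move: h.
  congr (0 <= _); apply: eq_bigr => w _; rewrite /g; lra.
have h3 : q%:R * lam * deg v <= cc.
  by have := vertex xv; rewrite -natr1; move: h2; lra.
have den : 0 < q%:R * lam * s.+1%:R by rewrite mulr_gt0 // mulr_gt0.
rewrite /L' mulrA ler_pdivlMr //.
by have := ler_wpM2l (ltW sR) h3; lra.
Qed.

(** The negative gap bounds T_(q+2) from above, the constraint bounds T_2 from below. *)
Let cc_gt : q%:R * lam * s.+1%:R * L < cc.
Proof.
have := gap_lt0; rewrite /gap subr_lt0 multiS mulr1 => h.
have T2' := T2_ge; rewrite multi2 mulr1 in T2'.
have := ler_wpM2l (mulr_ge0 (ler0n R q.+1) (ltW lam_gt0)) T2'.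
move: h; rewrite /cc !natrM.
have -> : s.+1%:R * (s ^_ q)%:R * (q.+2%:R * L ^+ q.+1 - q.+1%:R * s.+2%:R * L ^+ q.+2)
  = lam * s.+1%:R * L * (q.+2%:R - q.+1%:R * s.+2%:R * L).
  by rewrite /lam !exprS; ring.
by rewrite -![_.+2%:R]natr1 -![_.+1%:R]natr1; lra.
Qed.

Let LL' : L < L'.
Proof.
have den : 0 < q%:R * lam * s.+1%:R by rewrite mulr_gt0 // mulr_gt0.
by rewrite /L' ltr_pdivlMr // mulrC.
Qed.

Let L'_gt0 : 0 < L' := lt_trans L_gt0 LL'.

Let ccE : cc = q%:R * lam * s.+1%:R * L'.
Proof.
have den : q%:R * lam * s.+1%:R != 0 by rewrite gt_eqF // mulr_gt0 // mulr_gt0.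
by rewrite /L' mulrC divfK.
Qed.

Let lamK : lam < K.
Proof.
rewrite ltr_pM2l // ltr_pXn2r ?nnegrE ?ltW //.
Qed.

(* Raising the edge weights at v towards 1, including the loop at v, compares v with
   a twin of itself: the link sum of the pair (v, v) is that of v alone. *)
Let twin v : 0 < x v -> lam <= ksum a q (nb v).
Proof.
move=> xv.
have a'_w : edge_weights (fun u w => a u w + (1 - a u w) * cross R v u w).
  split=> u w; first by rewrite a_sym crossC.
  have /andP[t0 t1] := cross01 R v u w; have := a_ge0 u w; have := a_le1 u w.
  by move=> h1 h0; apply/andP; split; nra.
have := edge a'_w.
pose g u w : R := (1 - a u w) * (ksum a q (fun z => x z * a u z * a w z) - lam).
have g_sym u w : g u w = g w u by rewrite /g a_sym codeg_sym.
under eq_bigr => u _.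
  under eq_bigr => w _.
    have -> : (a u w + (1 - a u w) * cross R v u w - a u w)
        * (ksum a q (fun z => x z * a u z * a w z) - lam) = cross R v u w * g u w.
      by rewrite /g; lra.
    over.
  over.
rewrite sum_cross // pmulr_rge0 // => h.
have h2 : 0 <= (1 - deg v) * (ksum a q (nb v) - lam).
  apply: le_trans h _; rewrite -x1 /deg /mass -sumrB mulr_suml; apply: ler_sum => w _.
  have -> : x w - x w * a v w = x w * (1 - a v w) by ring.
  rewrite /g mulrA ler_wpM2l ?mulr_ge0 ?subr_ge0 //.
  rewrite lerD2r; apply: ksum_mono => // z.
  by rewrite mulr_ge0 //= ler_piMr.
have deg1 : deg v <= 1.
  by rewrite -x1; apply: ler_sum => w _; rewrite ler_piMr.
move: deg1; rewrite le_eqVlt => /predU1P[deg1|deg1]; last first.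
  by move: h2; rewrite pmulr_rge0 ?subr_gt0 // subr_ge0.
(* If v has degree 1, its link is x itself, and [vertex] contradicts density for q+1 because L <
   L'. *)
have nbE : nb v =1 x.
  have : \sum_u (x u - x u * a v u) = 0 by rewrite sumrB -/(mass x) x1 -deg1 subrr.
  move/psumr_eq0P => E u; apply/eqP; rewrite eq_sym -subr_eq0; apply/eqP.
  by apply: E => // w _; rewrite subr_ge0 ler_piMr.
have := vertex xv; rewrite (eq_ksum _ _ nbE) deg1 mulr1 ccE => TE.
have := @dense1 s.+1 _ x L x_ge0; rewrite x1 leqnn => /(_ isT).
have [_ _ _ -> _] := fx => /(_ isT T2_ge).
rewrite TE /multi succnK (ffactSS s q) (natrM _ s.+1).
have h3 : (s ^_ q)%:R <= (s.+1 ^_ q)%:R :> R by rewrite ler_nat leq_ffact.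
have h4 : 0 <= 1 - s.+1%:R * L by case/andP: L_bounds => h4 _; rewrite subr_ge0 ltW.
have h5 : lam * (1 - s.+1%:R * L) <= (s.+1 ^_ q)%:R * L ^+ q * (1 - s.+1%:R * L).
  by rewrite ler_wpM2r // ler_wpM2r // exprn_ge0 // ltW.
have h6 := ler_wpM2l (ler0n R q.+1) h5.
have h7 : q%:R * lam * s.+1%:R * L < q%:R * lam * s.+1%:R * L'.
  by rewrite ltr_pM2l // mulr_gt0 // mulr_gt0.
move=> h8; exfalso; move: h6 h7 h8.
rewrite exprS -[q.+1%:R]natr1 -/lam.
have -> : s.+1%:R * (s ^_ q)%:R * (L * L ^+ q) = s.+1%:R * lam * L by rewrite /lam; ring.
lra.
Qed.

Let local v : 0 < x v ->
  lam * (multi s q.+2 L' (deg v) - C * K * multi s 2 L' (deg v))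
  <= K * (ksum a q.+2 (nb v) - C * lam * ksum a 2 (nb v)).
Proof.
move=> xv.
have TE : ksum a q.+1 (nb v) = lam * (q.+1%:R * mass (nb v) - q%:R * s.+1%:R * L').
  by rewrite (vertex xv) ccE -/(deg v); ring.
have s0 : (0 < s)%N by case/andP: qs => q0; apply: leq_trans.
have [dle|dgt] := leP (deg v) (s%:R * L').
  by apply: local_low => //; [exact: ltW|exact: twin].
apply: local_high => //; first by apply: dense1; rewrite s0 leqnSn.
by rewrite dgt deg_ub.
Qed.

Let S2 := \sum_v x v * deg v ^+ 2.

Let T2E : T 2 = \sum_v x v * deg v. Proof. exact: ksum2. Qed.

Let sum_tau : \sum_v x v * (deg v * ksum a q.+1 (nb v)) = q.+1%:R * lam * S2 - cc * T 2.
Proof.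
rewrite /S2 T2E !mulr_sumr -sumrB; apply: eq_bigr => v _.
have := x_ge0 v; rewrite le_eqVlt => /predU1P[<-|xv]; first by rewrite !mul0r !mulr0 subrr.
by rewrite (vertex xv); ring.
Qed.

(* The weight of the common non-neighbours of v and u. *)
Let N v u := \sum_w x w * ((1 - a w v) * (1 - a w u)).

Let N01 v u : 0 <= N v u <= 1.
Proof.
apply/andP; split.
  by apply: sumr_ge0 => w _; rewrite !mulr_ge0 // subr_ge0.
rewrite -x1; apply: ler_sum => w _; rewrite ler_piMr //.
by rewrite mulr_ile1 ?subr_ge0 // lerBlDr lerDl.
Qed.

Let NC v u : N v u = N u v.
Proof. by apply: eq_bigr => w _; rewrite [_ * (1 - a w u)]mulrC. Qed.

Let sum_N : \sum_v x v * \sum_u x u * (a v u * N v u) = T 2 - 2 * S2 + T 3.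
Proof.
have E1 : \sum_v x v * \sum_u x u * (a v u * \sum_w x w * a w v) = S2.
  apply: eq_bigr => v _; congr (_ * _); rewrite expr2 {1}/deg /mass mulr_suml.
  apply: eq_bigr => u _; rewrite mulrA; congr (_ * _).
  by apply: eq_bigr => w _; rewrite a_sym.
have E2 : \sum_v x v * \sum_u x u * (a v u * \sum_w x w * a w u) = S2.
  rewrite -E1; under eq_bigr do rewrite mulr_sumr.
  rewrite exchange_big; apply: eq_bigr => u _; rewrite mulr_sumr.
  by apply: eq_bigr => v _; rewrite a_sym; ring.
have E3 : \sum_v x v * \sum_u x u * (a v u * \sum_w x w * (a w v * a w u)) = T 3.
  rewrite ksumS; apply: eq_bigr => v _; congr (_ * _); rewrite ksum2.
  apply: eq_bigr => u _; rewrite !mulr_sumr; apply: eq_bigr => w _.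
  by rewrite (a_sym w v) (a_sym w u); ring.
have -> : T 2 - 2 * S2 + T 3 = T 2 - S2 - S2 + T 3 by ring.
rewrite -{1}E1 -E2 -E3 ksum2 -!sumrB -big_split; apply: eq_bigr => v _ /=.
rewrite -!mulrBr -mulrDr -!sumrB -big_split; congr (_ * _); apply: eq_bigr => u _ /=.
have -> : N v u = 1 - (\sum_w x w * a w v) - (\sum_w x w * a w u)
    + \sum_w x w * (a w v * a w u).
  by rewrite -x1 /mass -!sumrB -big_split; apply: eq_bigr => w _ /=; ring.
ring.
Qed.

(** Bonferroni for restricting x to the link of w, that is b = 1 - a w, averaged over w. The pair
    term counts edges weighted by their common non-neighbours and is bounded by [edge] with a' = a
    (1 - N). The squared degrees cancel because 2 C = (q+2) (q+1). *)
Let bonf : q.+1%:R * T q.+2 + q.+2%:R * cc * T 2 + T q.+3 <= C * lam * (T 2 + T 3).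
Proof.
pose k v u := ksum a q (fun w => x w * a v w * a u w).
have h1 : \sum_v x v * \sum_u x u * (a v u * N v u * k v u)
    <= lam * (T 2 - 2 * S2 + T 3).
  have a'_w : edge_weights (fun u w => a u w * (1 - N u w)).
    split=> u w; first by rewrite a_sym NC.
    have /andP[n0 n1] := N01 u w.
    by rewrite mulr_ge0 ?subr_ge0 //= mulr_ile1 ?subr_ge0 // lerBlDr lerDl.
  rewrite -subr_ge0 -sum_N mulr_sumr -sumrB; move: (edge a'_w).
  congr (0 <= _); apply: eq_bigr => v _; rewrite [lam * _]mulrCA -mulrBr.
  congr (_ * _); rewrite mulr_sumr -sumrB; apply: eq_bigr => u _.
  rewrite -/(k v u); ring.
have h2 : T q.+3 <= T q.+2 - q.+2%:R * (T q.+2 - \sum_v x v * (deg v * ksum a q.+1 (nb v)))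
    + C * \sum_v x v * \sum_u x u * (a v u * N v u * k v u).
  have -> : T q.+2 - \sum_v x v * (deg v * ksum a q.+1 (nb v))
    = \sum_w x w * \sum_v x v * (1 - a w v) * ksum a q.+1 (nb v).
    under [RHS]eq_bigr do rewrite mulr_sumr.
    rewrite exchange_big ksumS -sumrB; apply: eq_bigr => v _ /=.
    have -> : x v * ksum a q.+1 (nb v) - x v * (deg v * ksum a q.+1 (nb v))
      = (1 - deg v) * (x v * ksum a q.+1 (nb v)) by ring.
    have -> : 1 - deg v = \sum_w (x w - x w * a v w) by rewrite -x1 /deg /mass -sumrB.
    by rewrite mulr_suml; apply: eq_bigr => w _; rewrite (a_sym v w); ring.
  have -> : \sum_v x v * \sum_u x u * (a v u * N v u * k v u)
    = \sum_w x w * \sum_v x v * \sum_u x u * (a v u * (1 - a w v) * (1 - a w u)) * k v u.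
    under [RHS]eq_bigr do rewrite mulr_sumr.
    rewrite [RHS]exchange_big; apply: eq_bigr => v _ /=.
    under [RHS]eq_bigr do rewrite !mulr_sumr.
    rewrite [RHS]exchange_big mulr_sumr; apply: eq_bigr => u _ /=.
    by rewrite /N !(mulr_sumr, mulr_suml); apply: eq_bigr => w _; ring.
  have -> : T q.+2 = \sum_w x w * T q.+2 by rewrite -mulr_suml -/(mass x) x1 mul1r.
  rewrite ksumS !mulr_sumr -sumrB -big_split; apply: ler_sum => w _ /=.
  rewrite ![_%:R * (x w * _)]mulrCA -mulrBr -mulrDr ler_wpM2l //.
  have b01 v : 0 <= 1 - a w v <= 1 by rewrite subr_ge0 a_le1 lerBlDr lerDl a_ge0.
  have [_] := bonferroni a_w q.+2 x_ge0 b01.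
  apply: le_trans; rewrite le_eqVlt; apply/orP; left; apply/eqP.
  by apply: eq_ksum => v; rewrite subKr.
rewrite sum_tau in h2.
have h3 := ler_wpM2l (ltW C_gt0) h1.
have E : C * (lam * (T 2 - 2 * S2 + T 3))
  = C * lam * (T 2 + T 3) - q.+2%:R * q.+1%:R * lam * S2 by rewrite -C2; ring.
rewrite E in h3.
rewrite -[q.+2%:R]natr1 in h2 h3 *; lra.
Qed.

(** [multi] is affine in the mass, so summing [local] over all links involves the degrees only
    through T_2. Adding [bonf] cancels T_3 and T_(q+3) and leaves T_2 <= multi (s+1) 2 L' 1. Beyond
    1 / (s+2) this comparison sum decreases in the part size, and L' > L. *)
Lemma min_gap_absurd : False.
Proof.
have K0 : 0 < K := lt_trans lam_gt0 lamK.
pose al : R := L' ^+ 2 * s.+1%:R * q.+1%:R * q%:R * s.+2%:R / 2.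
pose be : R := - (L' * q.+2%:R * q%:R * s.+1%:R).
have CE : C = q.+2%:R * q.+1%:R / 2 by rewrite -C2; field.
have affine v : multi s q.+2 L' (deg v) - C * K * multi s 2 L' (deg v)
    = K * (al + be * deg v).
  rewrite multi_pred multi2 CE /K /al /be exprS -![_.+2%:R]natr1 -![_.+1%:R]natr1.
  by field.
have h : lam * (al + be * T 2) <= T q.+3 - C * lam * T 3.
  rewrite [T q.+3]ksumS [T 3]ksumS ksum2 !mulr_sumr -sumrB.
  have -> : lam * (al + \sum_v be * (x v * \sum_u x u * a v u))
      = \sum_v x v * (lam * (al + be * deg v)).
    have alE : al = \sum_v x v * al by rewrite -mulr_suml -/(mass x) x1 mul1r.
    rewrite {1}alE -big_split mulr_sumr.
    by apply: eq_bigr => v _ /=; rewrite -/(mass (nb v)) -/(deg v); ring.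
  apply: ler_sum => v _; rewrite [C * lam * _]mulrCA -mulrBr.
  have := x_ge0 v; rewrite le_eqVlt => /predU1P[<-|xv]; first by rewrite !mul0r.
  rewrite ler_pM2l // -(ler_pM2l K0); apply: le_trans (local xv).
  by rewrite affine mulrCA lexx.
have Tq : T q.+2 = q.+1%:R * lam * T 2 - cc by rewrite /cc; ring.
have main : T 2 <= multi s.+1 2 L' 1.
  have b := bonf; rewrite Tq in b.
  have h2 : lam * (q.+1%:R * q%:R / 2) * T 2 <= lam * (q.+1%:R * q%:R / 2) * multi s.+1 2 L' 1.
    rewrite -subr_ge0; have := addr_ge0 (etrans (subr_ge0 _ _) b) (etrans (subr_ge0 _ _) h).
    congr (0 <= _); rewrite ccE CE /al /be multi2 -![_.+2%:R]natr1 -![_.+1%:R]natr1.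
    by field.
  move: h2; rewrite ler_pM2l //; apply: mulr_gt0 => //.
  by rewrite divr_gt0 // mulr_gt0 // ltr0n.
have := le_trans T2_ge main; rewrite leNgt; apply/negP/negPn.
have /andP[_ s2L] := L_bounds.
rewrite !multi2 -subr_gt0.
have -> : 2 * s.+1%:R * L * 1 - s.+1%:R * (s.+1%:R + 1) * L ^+ 2
    - (2 * s.+1%:R * L' * 1 - s.+1%:R * (s.+1%:R + 1) * L' ^+ 2)
  = s.+1%:R * (L' - L) * ((s.+2%:R * L - 1) + (s.+2%:R * L' - 1)).
  by rewrite -[s.+2%:R]natr1; ring.
rewrite mulr_gt0 ?mulr_gt0 ?subr_gt0 // addr_gt0 ?subr_gt0 //.
by rewrite (lt_trans s2L) // ltr_pM2l.
Qed.

End AtMinimum.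

(** * The clique density theorem *)

Section CliqueDensity.
Variables (R : realType) (V : finType).

Lemma dense_normalised s r (a : V -> V -> R) : edge_weights a ->
  (forall x L, feasible s a x L -> multi s.+1 r.+2 L 1 <= ksum a r.+2 x) ->
  dense a s.+1 r.+2.
Proof.
move=> a_w H x L x0 Lm T2.
have m0 : 0 <= mass x by apply: sumr_ge0.
move: m0; rewrite le_eqVlt => /predU1P[m0|m0].
  have L0 : L = 0.
    move: Lm; rewrite -m0 pmulr_rle0 ?ltr0n // pmulr_rge0 ?ltr0n // => ?.
    exact: le_anti.
  by rewrite -m0 L0 multiS !exprS !mul0r !mulr0 subrr mulr0 ksum_ge0.
set m := mass x in m0 Lm T2 *.
pose y v := m^-1 * x v.
have my : mass y = 1 by rewrite /mass -mulr_sumr mulVf // gt_eqF.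
have xE v : x v = m * y v by rewrite /y mulrA divff ?mul1r // gt_eqF.
have LE : L = m * (m^-1 * L) by rewrite mulrA divff ?mul1r // gt_eqF.
have TE j : ksum a j x = m ^+ j * ksum a j y by rewrite -ksumZ; apply: eq_ksum.
have ME j : multi s.+1 j L m = m ^+ j * multi s.+1 j (m^-1 * L) 1.
  by rewrite -multiZ mulr1 -LE.
rewrite TE ME ler_pM2l ?exprn_gt0 //; apply: H; split=> //.
- by move=> v; rewrite mulr_ge0 // invr_ge0 ltW.
- by rewrite ![_ * (m^-1 * L)]mulrCA ler_pdivrMl // ler_pdivlMl // mulr1.
- by move: T2; rewrite TE ME ler_pM2l ?exprn_gt0.
Qed.

(** Induction on the clique size and, inside, strong induction on s: links need density for one size
    less with up to s parts, and for the same size with fewer parts. *)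
Theorem clique_density s r (a : V -> V -> R) : (0 < s)%N -> edge_weights a ->
  dense a s r.
Proof.
case: r => [|[|q]] s0.
- by move=> a_w x L x0 _ _; rewrite /multi !mul0r addr0 ffactn0 mul1r.
- move=> a_w x L x0 _ _; rewrite ksum1 /multi ffactn0 ffactn1 expr0 expr1; lra.
elim: q s s0 a => [|q IHq] s s0 a a_w; first by [].
elim/ltn_ind: s s0 a a_w => -[//|s] IHs _ a a_w.
(* With too few parts the comparison graph has no clique of this size. *)
have [sq|qs] := ltnP s q.+1.
  move=> x L x0 _ _; rewrite multiS ffact_small // muln0 mul0r; exact: ksum_ge0.
apply: dense_normalised => // x1 L1 f1; rewrite leNgt; apply/negP => bad.
have [b [y [M [fy ymin]]]] := exists_min_gap q.+1 f1.
have b_w : edge_weights b by case: fy.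
apply: (@min_gap_absurd R V s q.+1 b y M) => //.
- by rewrite (le_lt_trans (ymin _ _ _ f1)) // subr_lt0.
- by move=> p /andP[p0 _]; apply: IHq.
- by move=> p /andP[p0 ps]; apply: IHs.
Qed.

End CliqueDensity.

(** * Cliques of a graph *)

Section Adjacency.
Variables (R : realFieldType) (V : finType) (G : sgraph V).
Implicit Types (A B : {set V}) (x : V -> R).

Definition adjw (u v : V) : R := (G u v)%:R.

Lemma adjw_weights : edge_weights adjw.
Proof.
split=> u v; first by rewrite /adjw (adj_sym G).
by rewrite /adjw ler0n lern1 leq_b1.
Qed.

Lemma cliqueP A : reflect {in A &, forall u v, u != v -> G u v} (clique G A).
Proof.
apply: (iffP forall_inP) => [h u v uA vA uv|h u uA].
  by have /forall_inP/(_ v vA)/implyP/(_ uv) := h u uA.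
by apply/forall_inP => v vA; apply/implyP; exact: h.
Qed.

Lemma cliqueU1 v A : v \notin A ->
  clique G (v |: A) = clique G A && [forall u in A, G v u].
Proof.
move=> vA; apply/cliqueP/andP => [h|[/cliqueP h /forall_inP hv] u w].
  split; first by apply/cliqueP => u w uA wA; apply: h; exact: finset.setU1r.
  apply/forall_inP => u uA; apply: h; rewrite ?finset.setU11 ?finset.setU1r //.
  by apply: contraNneq vA => ->.
rewrite !inE => /predU1P[->|uA] /predU1P[->|wA]; rewrite ?eqxx // => uw.
- exact: hv.
- by rewrite (adj_sym G); exact: hv.
- exact: h.
Qed.

Lemma prod_adjw v A x : v \notin A ->
  \prod_(u in A) (x u * adjw v u) = \prod_(u in A) x u * [forall u in A, G v u]%:R.
Proof.
move=> vA; rewrite big_split; congr (_ * _).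
have [/forall_inP h|/forall_inPn[u uA nuv]] := boolP [forall u in A, G v u].
  by rewrite big1 // => u uA; rewrite /adjw h.
by rewrite (bigD1 u) //= {1}/adjw (negPf nuv) mul0r.
Qed.

Lemma ksum_clique t x : ksum adjw t x =
  t`!%:R * \sum_(A : {set V} | clique G A && (#|A| == t)) \prod_(v in A) x v.
Proof.
elim: t x => [|t IH] x.
  rewrite ksum0 (big_pred1 finset.set0) ?big_set0 ?mulr1 // => A.
  rewrite cards_eq0 andbC /=; have [->|//] := eqVneq A finset.set0.
  by apply/cliqueP => u v; rewrite finset.in_set0.
rewrite ksumS factS natrM.
transitivity (t`!%:R * \sum_v \sum_(B : {set V} | (clique G B && (#|B| == t.+1)) && (v \in B))
    \prod_(u in B) x u).
  rewrite mulr_sumr; apply: eq_bigr => v _; rewrite IH mulrCA; congr (_ * _).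
  rewrite mulr_sumr (bigID (fun A : {set V} => v \in A)) /= big1 ?add0r; last first.
    move=> A /andP[_ vA]; rewrite (bigD1 v) //= {1}/adjw (adj_irr G) mulr0 mul0r.
    by rewrite mulr0.
  under eq_bigr => A /andP[_ vA] do rewrite prod_adjw //.
  rewrite (reindex_onto (fun B => B :\ v) (fun A => v |: A)) /=; last first.
    by move=> A /andP[_ vA]; rewrite finset.setU1K.
  rewrite (bigID (fun B : {set V} => [forall u in B :\ v, G v u])) /=.
  rewrite [X in _ + X]big1 ?addr0; last by move=> B /andP[_ /negPf->]; rewrite !mulr0.
  apply: eq_big => [B|B /andP[/andP[/andP[_ vB] /eqP EB] ->]]; last first.
    have vB' : v \in B by rewrite -EB finset.setU11.
    by rewrite mulr1 [RHS](bigD1 v) //=; congr (_ * _); apply: eq_bigl => u; rewrite !inE andbC.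
  have [vB|vB] := boolP (v \in B); last first.
    rewrite andbF; apply/negP => /andP[/andP[_ /eqP EB] _]; move: vB.
    by rewrite -EB finset.setU11.
  have EB : v |: B :\ v = B by rewrite finset.setD1K.
  have cB : clique G B = clique G (B :\ v) && [forall u in B :\ v, G v u].
    by rewrite -{1}EB cliqueU1 ?finset.setD11.
  rewrite EB cB (cardsD1 v B) vB finset.setD11 eqxx add1n eqSS !andbT.
  by rewrite -!andbA; congr (_ && _); exact: andbC.
rewrite -[RHS]mulrA [RHS]mulrCA; congr (_ * _).
rewrite (exchange_big_dep (fun B : {set V} => clique G B && (#|B| == t.+1))) /=; last first.
  by move=> v B _ /andP[].
rewrite mulr_sumr; apply: eq_bigr => B /andP[-> /eqP cB] /=.
rewrite (eq_bigl (fun v => v \in B)); last by move=> v; rewrite cB eqxx.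
by rewrite sumr_const cB mulr_natl.
Qed.

Lemma ksum_cliquefree k t x : (forall A, clique G A -> (#|A| <= k)%N) -> (k < t)%N ->
  ksum adjw t x = 0.
Proof.
move=> kfree kt; rewrite ksum_clique big_pred0 ?mulr0 // => A; apply/negP.
by move=> /andP[/kfree Ak /eqP At]; rewrite At leqNgt kt in Ak.
Qed.

End Adjacency.

(** * Local edge density *)

Section TwoForms.
Variables (R : realFieldType) (V : finType) (a : V -> V -> R).
Hypothesis a_sym : forall u v, a u v = a v u.
Implicit Types f h : V -> R.

Definition wdeg f v := \sum_u f u * a v u.

Lemma sum_delta b f : \sum_v (v == b)%:R * f v = f b.
Proof.
rewrite (bigD1 b) //= eqxx mul1r big1 ?addr0 // => v /negPf->.
by rewrite mul0r.
Qed.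

Lemma ksum2_wdeg f : ksum a 2 f = \sum_v f v * wdeg f v.
Proof. exact: ksum2. Qed.

Lemma ksum2D f h :
  ksum a 2 (fun v => f v + h v) = ksum a 2 f + 2 * \sum_v h v * wdeg f v + ksum a 2 h.
Proof.
have E : \sum_v f v * wdeg h v = \sum_v h v * wdeg f v.
  rewrite /wdeg; under eq_bigr do rewrite mulr_sumr.
  rewrite exchange_big; apply: eq_bigr => u _; rewrite mulr_sumr.
  by apply: eq_bigr => v _; rewrite a_sym; ring.
have -> : 2 * \sum_v h v * wdeg f v
  = \sum_v f v * wdeg h v + \sum_v h v * wdeg f v by rewrite E; ring.
rewrite !ksum2_wdeg -!big_split; apply: eq_bigr => v _ /=.
have -> : wdeg (fun v => f v + h v) v = wdeg f v + wdeg h v.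
  by rewrite /wdeg -big_split; apply: eq_bigr => u _; rewrite mulrDl.
ring.
Qed.

Lemma dksum2 f f' : dksum a a f f' 2 = 2 * \sum_v (f' v - f v) * wdeg f v.
Proof.
rewrite /dksum /ksum_at2 [X in _ + _ * X]big1 ?mulr0 ?addr0.
  by congr (_ * _); apply: eq_bigr => v _; rewrite ksum1.
by move=> v _; rewrite big1 ?mulr0 // => u _; rewrite subrr mulr0 mul0r.
Qed.

End TwoForms.

Section LocalDensity.
Variables (R : realType) (V : finType) (G : sgraph V) (S j : nat).
Hypotheses (S0 : (0 < S)%N) (j0 : (0 < j)%N).
Hypothesis kfree : forall A : {set V}, clique G A -> (#|A| <= S + j)%N.
Implicit Types (p q : V -> R) (X al : R).

Local Notation a := (adjw R G).
Local Notation T2 := (ksum a 2).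
Local Notation dg := (wdeg a).

(* [dens X] is the edge sum of the complete multipartite graph of mass 1 with S parts
   of weight X and j parts of weight [rest X]; [bound al X] is that of S parts of weight
   X and a remainder of total mass al.  If the remainder is heavier than [rest X], it
   spreads over several of the small parts, and [slope] measures the
   additional edges; for j = 1 there is no excess and [slope] is the junk value
   1 / 0 = 0. *)
Definition rest X : R := (1 - S%:R * X) / j%:R.
Definition dens X : R := 1 - S%:R * X ^+ 2 - j%:R * rest X ^+ 2.
Definition excess al X : R := al - S%:R * X - rest X.
Definition slope : R := j%:R / (j%:R - 1).
Definition bound al X : R := S%:R * X * (2 * al - S.+1%:R * X).
Definition over al X : R := Num.max 0 (excess al X).
Definition sbound al X : R := bound al X + slope * over al X ^+ 2.

(** The bounds on X say that [rest X] lies between 0 and X. *)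
Definition feas p q X :=
  [/\ (forall v, 0 <= p v), (forall v, 0 <= q v), mass p + mass q = 1,
      1 <= (S + j)%:R * X /\ S%:R * X <= 1
    & dens X <= T2 (fun v => p v + q v)].

Definition defect p X := T2 p - sbound (mass p) X.

Let SR : 0 < S%:R :> R. Proof. by rewrite ltr0n. Qed.
Let jR : 0 < j%:R :> R. Proof. by rewrite ltr0n. Qed.
Let kR : 0 < (S + j)%:R :> R. Proof. by rewrite ltr0n addn_gt0 S0. Qed.
Let aw := adjw_weights R G.
Let a_sym u v : a u v = a v u. Proof. by case: aw. Qed.
Let a01 u v : 0 <= a u v <= 1. Proof. by case: aw => _; apply. Qed.
Let avv v : a v v = 0. Proof. by rewrite /adjw (adj_irr G). Qed.

Let slope_ge0 : 0 <= slope.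
Proof. by rewrite /slope divr_ge0 ?ler0n // subr_ge0 ler1n. Qed.

Let restE X : j%:R * rest X = 1 - S%:R * X.
Proof. by rewrite /rest mulrC divfK // gt_eqF. Qed.

Let slopeE : (1 < j)%N -> slope * (j%:R - 1) = j%:R.
Proof. by move=> j1; rewrite /slope divfK // gt_eqF // subr_gt0 ltr1n. Qed.

(** The defect depends on p and X only, so q can be chosen anew, with smallest support, after
    minimising. *)
Lemma exists_min_defect p1 q1 X1 : feas p1 q1 X1 ->
  exists p q X, [/\ feas p q X,
    forall p' q' X', feas p' q' X' -> defect p X <= defect p' X'
    & forall q', feas p q' X -> (#|[pred v | q v != 0%R]| <= #|[pred v | q' v != 0%R]|)%N].
Proof.
move=> f1.
have [p [X [[q fq] pmin]]] : exists p X, (exists q, feas p q X) /\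
    forall p' q' X', feas p' q' X' -> defect p X <= defect p' X'.
  pose I := (V + V + unit)%type.
  pose P (v : V) (f : coords R I) : R := f (inl (inl v)).
  pose Q (v : V) (f : coords R I) : R := f (inl (inr v)).
  pose XX (f : coords R I) : R := f (inr tt).
  have cP v : continuous (P v) by exact: cts_coord.
  have cQ v : continuous (Q v) by exact: cts_coord.
  have cX : continuous XX by exact: cts_coord.
  have c_ k := @cts_cst R (coords R I) k.
  have cmP : continuous (fun f => mass (fun v => P v f)) by exact: cts_sum.
  have cmQ : continuous (fun f => mass (fun v => Q v f)) by exact: cts_sum.
  have crest : continuous (fun f => rest (XX f)).
    by apply: ctsM => //; apply: ctsB => //; apply: ctsM.
  have cdens : continuous (fun f => dens (XX f)).
    apply: ctsB; last by apply: ctsM => //; apply: ctsX.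
    by apply: ctsB => //; apply: ctsM => //; apply: ctsX.
  have cK (F : V -> coords R I -> R) : (forall v, continuous (F v)) ->
      continuous (fun f => T2 (fun v => F v f)).
    by move=> cF; apply: (@cts_ksum R _ V (fun u v _ => a u v)).
  have cdef : continuous (fun f => defect (fun v => P v f) (XX f)).
    apply: ctsB; first exact: cK.
    apply: ctsD.
      apply: ctsM; first exact: ctsM.
      by apply: ctsB; apply: ctsM.
    apply: ctsM => //; apply: ctsX; apply: cts_max => //.
    by apply: ctsB => //; apply: ctsB => //; apply: ctsM.
  pose g (i : nat) (f : coords R I) : R := match i with
    | 0 => (mass (fun v => P v f) + mass (fun v => Q v f)) - 1
    | 1 => 1 - (mass (fun v => P v f) + mass (fun v => Q v f))
    | 2 => (S + j)%:R * XX f - 1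
    | 3 => 1 - S%:R * XX f
    | _ => T2 (fun v => P v f + Q v f) - dens (XX f)
    end.
  have cg i : continuous (g i).
    case: i => [|[|[|[|i]]]]; apply: ctsB => //; try exact: ctsD; try exact: ctsM.
    by apply: cK => v; exact: ctsD.
  pose mk p q X : coords R I := fun i => match i with
    | inl (inl v) => p v | inl (inr v) => q v | inr _ => X end.
  have mkD p q X : feas p q X ->
      (forall i, 0 <= mk p q X i <= 1) /\ (forall i, 0 <= g i (mk p q X)).
    move=> [p0 q0 m [X1' X2'] T]; split.
      move=> [[v|v]|[]] /=.
      - rewrite p0 -m /mass (bigD1 v) //= -addrA lerDl addr_ge0 //; exact: sumr_ge0.
      - rewrite q0 -m /mass [X in _ <= _ + X](bigD1 v) //= addrCA lerDl addr_ge0 //; exact: sumr_ge0.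
      - have X0 : 0 <= X by rewrite -(pmulr_rge0 _ kR) (le_trans _ X1').
        rewrite X0 /= (le_trans _ X2') // ler_peMl // ler1n //.
    by move=> [|[|[|[|i]]]]; rewrite /g subr_ge0 // -m.
  have Dfeas f : (forall i, 0 <= f i <= 1) -> (forall i, 0 <= g i f) ->
      feas (fun v => P v f) (fun v => Q v f) (XX f).
    move=> f01 gf; split.
    - by move=> v; case/andP: (f01 (inl (inl v))).
    - by move=> v; case/andP: (f01 (inl (inr v))).
    - by have := gf 0%N; have := gf 1%N; rewrite /= !subr_ge0 => ? ?; apply/le_anti/andP.
    - by have := gf 2%N; have := gf 3%N; rewrite /= !subr_ge0.
    - by have := gf 4%N; rewrite /= subr_ge0.
  have [f [f01 gf] fmin] := box_min cg cdef (mkD _ _ _ f1).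
  exists (fun v => P v f), (XX f); split.
    by exists (fun v => Q v f); exact: Dfeas.
  by move=> p' q' X' h; exact: fmin _ (mkD _ _ _ h).
pose supp_ok n := `[< exists2 q', feas p q' X & #|[pred v | q' v != 0%R]| = n >].
have ex : exists n, supp_ok n by exists #|[pred v | q v != 0%R]|; apply/asboolP; exists q.
case: (ex_minnP ex) => n /asboolP[q' fq' <-] nmin.
exists p, q', X; split=> // q2 fq2; apply: nmin; apply/asboolP; by exists q2.
Qed.

(** Convexity. In [defect_deriv] the tangent replaces the squared maximum, which is no polynomial;
    the result majorises the defect and agrees with it at 0. *)
Lemma max_sqr_tangent (u v : R) :
  Num.max 0 u ^+ 2 + 2 * Num.max 0 u * (v - u) <= Num.max 0 v ^+ 2.
Proof.
have sq := sqr_ge0 (u - v); have sv := sqr_ge0 v.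
have [u0|u0] := leP 0 u; have [v0|v0] := leP 0 v; try lra.
have := mulr_ge0_le0 u0 (ltW v0); have := sqr_ge0 u; lra.
Qed.

(** c stands for the condition under which the moved triple remains feasible: the edge constraint in
    [kkt], a trivial one in [kkt_swap]. *)
Lemma defect_deriv p q X p' q' t (c : {poly R}) e :
  feas p q X ->
  (forall p' q' X', feas p' q' X' -> defect p X <= defect p' X') ->
  0 < e -> 0 <= c.[0] -> 0 < (deriv c).[0] ->
  (forall z, 0 < z < e -> 0 <= c.[z] ->
    feas (fun v => p v + z * (p' v - p v)) (fun v => q v + z * (q' v - q v)) (X + t * z)) ->
  0 <= \sum_v (p' v - p v) * dg p v
       - (S%:R * X + slope * over (mass p) X) * (mass p' - mass p)
       + t * S%:R * (X - (mass p - S%:R * X) + over (mass p) X).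
Proof.
move=> fp pmin e0 c0 dc feasz; set u := over _ _.
pose al := mass p; pose da := mass p' - mass p.
have affP b d : exists A : {poly R}, (forall z, A.[z] = b + d * z) /\ (deriv A).[0] = d.
  exists (b%:P + d%:P * 'X); split=> [z|]; first by rewrite !(hornerD, hornerM, hornerC, hornerX).
  by rewrite derivD derivM !derivC derivX mul0r !add0r mulr1 hornerC.
have [A [Az dA]] := affP al da.
have [Y [Yz dY]] := affP X t.
have [U [Uz dU]] : exists U : {poly R}, (forall z, U.[z] = excess (al + da * z) (X + t * z))
    /\ (deriv U).[0] = da - S%:R * t + S%:R * t / j%:R.
  exists (A - S%:R%:P * Y - (1%:P - S%:R%:P * Y) * (j%:R^-1)%:P); split=> [z|].
    by rewrite !(hornerD, hornerN, hornerM, hornerC) Az Yz /excess /rest.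
  rewrite !(derivB, derivM) !derivC !mul0r !add0r !mulr0 !addr0.
  rewrite !(hornerD, hornerN, hornerM, hornerC) dA dY; ring.
pose f : {poly R} := seg_ksum a a p p' 2 - S%:R%:P * Y * (2%:P * A - S.+1%:R%:P * Y)
  - slope%:P * ((u ^+ 2)%:P + (2 * u)%:P * (U - (excess al X)%:P)).
have fz z : f.[z] = T2 (fun v => p v + z * (p' v - p v)) - bound (al + da * z) (X + t * z)
    - slope * (u ^+ 2 + 2 * u * (excess (al + da * z) (X + t * z) - excess al X)).
  rewrite /f !(hornerD, hornerN, hornerM, hornerC) Az Yz Uz seg_ksum_at /bound.
  congr (ksum _ _ _ - _ - _); apply/funext => v; apply/funext => w.
  by rewrite subrr mulr0 addr0.
have f0 : f.[0] = defect p X.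
  rewrite fz !mulr0 !addr0 subrr mulr0 addr0 /defect /sbound opprD addrA.
  congr (ksum _ _ _ - _ - _); apply/funext => v; by rewrite mul0r addr0.
have massz z : mass (fun v => p v + z * (p' v - p v)) = al + da * z.
  by rewrite /mass big_split -mulr_sumr sumrB /= [da * z]mulrC.
have step z : 0 < z < e -> 0 <= c.[z] -> f.[0] <= f.[z].
  move=> ze cz; rewrite f0 (le_trans (pmin _ _ _ (feasz z ze cz))) //.
  rewrite fz /defect /sbound massz opprD addrA lerD2l lerN2 ler_wpM2l //.
  exact: max_sqr_tangent.
have := constrained_min_deriv_ge0 e0 step c0 dc.
have -> : (deriv f).[0] = 2 * (\sum_v (p' v - p v) * dg p v
    - (S%:R * X + slope * u) * da + t * S%:R * (X - (al - S%:R * X))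
    + t * S%:R * (u * (slope * (1 - j%:R^-1)))).
  rewrite /f !(derivB, derivD, derivM) !derivC !mul0r !add0r.
  rewrite !(hornerD, hornerN, hornerM, hornerC) seg_ksum_deriv0 // dksum2 // dA dY dU Yz Az.
  rewrite -[S.+1%:R]natr1 !(mulr0, addr0, subr0); ring.
rewrite pmulr_rge0 // => h; apply: le_trans h _; rewrite -!/al -/da.
have -> : t * S%:R * (u * (slope * (1 - j%:R^-1))) = t * S%:R * u; last by lra.
congr (_ * _); have [j1|j1] := ltnP 1 j.
  have -> : slope * (1 - j%:R^-1) = 1; last by rewrite mulr1.
  by rewrite /slope; field; rewrite !gt_eqF // subr_gt0 ltr1n.
(* Here [slope] is 0, but mass p <= 1 rules out any excess, so both sides vanish. *)
have jE : j = 1%N by apply/eqP; rewrite eqn_leq j1.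
suff -> : u = 0 by rewrite mul0r.
have [p0 q0 m _ _] := fp.
rewrite /u /over max_l // /excess /rest jE divr1 subr_le0.
have : 0 <= mass q by apply: sumr_ge0.
rewrite -m; lra.
Qed.

(** At most 1 - (mass p)^2 of the edge sum lies outside p; what remains is (mass p - 1)^2 >= 0. *)
Lemma defect_ge0_rest0 p q X : feas p q X -> S%:R * X = 1 -> 0 <= defect p X.
Proof.
move=> [p0 q0 m _ T] SX; have Y0 : rest X = 0 by rewrite /rest SX subrr mul0r.
have al1 : mass p <= 1 by rewrite -m lerDl; apply: sumr_ge0.
have u0 : over (mass p) X = 0 by rewrite /over max_l // /excess Y0 SX; lra.
have T2w : T2 (fun v => p v + q v) <= T2 p + (1 - mass p ^+ 2).
  rewrite ksum2D // -addrA lerD2l.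
  have dg_le f : (forall v, 0 <= f v) -> forall v, dg f v <= mass f.
    move=> f0 v; apply: ler_sum => u _; have /andP[? ?] := a01 v u.
    by rewrite ler_piMr.
  have h1 : \sum_v q v * dg p v <= mass q * mass p.
    by rewrite mulr_suml; apply: ler_sum => v _; rewrite ler_wpM2l // dg_le.
  have h2 : T2 q <= mass q * mass q.
    by rewrite ksum2 mulr_suml; apply: ler_sum => v _; rewrite ler_wpM2l // dg_le.
  have mq : mass q = 1 - mass p by rewrite -m; ring.
  move: h1 h2; rewrite mq => h1 h2; lra.
rewrite /defect /sbound u0 expr0n mulr0 addr0 /bound.
move: T T2w; rewrite /dens Y0 expr0n mulr0 subr0.
have -> : S%:R * X ^+ 2 = X by rewrite expr2 mulrA SX mul1r.
have -> : S%:R * X * (2 * mass p - S.+1%:R * X) = 2 * mass p - 1 - X.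
  have SX1 : S.+1%:R * X = 1 + X by rewrite -natr1 mulrDl SX mul1r.
  by rewrite SX SX1; ring.
have := sqr_ge0 (mass p - 1); lra.
Qed.

(* The quotient is the Lagrange multiplier of the constraint [dens X <= T2 (p + q)],
   found by moving X along with p and q so that the constraint keeps holding. *)
Lemma kkt p q X p' q' : feas p q X ->
  (forall p' q' X', feas p' q' X' -> defect p X <= defect p' X') ->
  1 < (S + j)%:R * X -> S%:R * X < 1 ->
  (forall v, 0 <= p' v) -> (forall v, 0 <= q' v) -> mass p' + mass q' = 1 ->
  (X - (mass p - S%:R * X) + over (mass p) X) / (X - rest X)
    * \sum_v (p' v + q' v - (p v + q v)) * dg (fun v => p v + q v) v
  <= \sum_v (p' v - p v) * dg p v
     - (S%:R * X + slope * over (mass p) X) * (mass p' - mass p).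
Proof.
move=> fp pmin kX SX p'0 q'0 m'; have [p0 q0 m _ T] := fp.
pose w v := p v + q v; pose w' v := p' v + q' v.
set u := over _ _; set N := X - _ + u; set Sg := \sum_v _ * dg w v.
have XY : 0 < X - rest X.
  rewrite -(pmulr_rgt0 _ jR) mulrBr restE; move: kX; rewrite natrD; lra.
have NX : X - rest X <= N.
  have : excess (mass p) X <= u by rewrite /u /over le_max lexx orbT.
  rewrite /N /excess; lra.
set mu := N / _.
have mu0 : 0 <= mu by rewrite divr_ge0 // ltW // (lt_le_trans XY).
apply/ler_addgt0Pr => eps eps0.
pose ep := eps / (mu + 1).
have ep0 : 0 < ep by rewrite divr_gt0 // ltr_wpDl.
have epE : mu * ep <= eps.
  by rewrite /ep mulrA ler_pdivrMr ?ltr_wpDl // mulrC ler_pM2l // lerDl.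
(* The speed of X at which the slack of the edge constraint grows at rate 2 ep. *)
pose t := (ep - Sg) / (S%:R * (X - rest X)).
have tE : t * S%:R = (ep - Sg) / (X - rest X).
  by rewrite /t; field; rewrite !gt_eqF.
have [Y [Yz dY]] : exists Y : {poly R}, (forall z, Y.[z] = X + t * z) /\ (deriv Y).[0] = t.
  exists (X%:P + t%:P * 'X); split=> [z|]; first by rewrite !(hornerD, hornerM, hornerC, hornerX).
  by rewrite derivD derivM !derivC derivX mul0r !add0r mulr1 hornerC.
pose c : {poly R} := seg_ksum a a w w' 2
  - (1%:P - S%:R%:P * Y ^+ 2 - j%:R%:P * ((1%:P - S%:R%:P * Y) * (j%:R^-1)%:P) ^+ 2).
have cz z : c.[z] = T2 (fun v => w v + z * (w' v - w v)) - dens (X + t * z).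
  rewrite /c !(hornerD, hornerN, horner_exp, hornerM, hornerC) Yz seg_ksum_at /dens /rest.
  congr (ksum _ _ _ - _); apply/funext => v; apply/funext => y.
  by rewrite subrr mulr0 addr0.
have c0 : 0 <= c.[0].
  rewrite cz mulr0 addr0 subr_ge0; move: T; congr (_ <= ksum _ _ _).
  by apply/funext => v; rewrite mul0r addr0.
have dc : (deriv c).[0] = 2 * ep.
  rewrite /c !(derivB, deriv_exp, derivM) !derivC !mul0r !add0r !mulr0 !addr0.
  rewrite !(hornerD, hornerN, hornerMn, horner_exp, hornerM, hornerC) Yz dY seg_ksum_deriv0 // dksum2 //.
  rewrite -/Sg; have -> : ep = Sg + t * S%:R * (X - rest X).
    by rewrite tE divfK ?gt_eqF //; ring.
  by rewrite /rest; field; rewrite gt_eqF.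
pose wd := Num.min ((S + j)%:R * X - 1) (1 - S%:R * X).
have wd0 : 0 < wd by rewrite lt_min !subr_gt0 kX SX.
have t1 : 0 < `|t| + 1 by rewrite ltr_wpDl.
pose e := Num.min 1 (wd / ((S + j)%:R * (`|t| + 1))).
have e0 : 0 < e by rewrite lt_min ltr01 divr_gt0 // mulr_gt0.
have feasz z : 0 < z < e -> 0 <= c.[z] ->
    feas (fun v => p v + z * (p' v - p v)) (fun v => q v + z * (q' v - q v)) (X + t * z).
  move=> /andP[z0 ze] c_z.
  move: ze; rewrite lt_min ltr_pdivlMr ?mulr_gt0 // => /andP[z1 zw].
  have cvx (b d : R) : 0 <= b -> 0 <= d -> 0 <= b + z * (d - b).
    move=> b0 d0; have -> : b + z * (d - b) = (1 - z) * b + z * d by ring.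
    by rewrite addr_ge0 // mulr_ge0 ?subr_ge0 // ltW.
  have tz : `|t * z| * (S + j)%:R <= wd.
    rewrite normrM (gtr0_norm z0); apply: le_trans (ltW zw).
    have : 0 <= z * (S + j)%:R by rewrite mulr_ge0 // ltW.
    lra.
  have tzn : `|t * z| * S%:R <= wd.
    by apply: le_trans tz; rewrite ler_wpM2l // ler_nat leq_addr.
  have [w1 w2] : wd <= (S + j)%:R * X - 1 /\ wd <= 1 - S%:R * X.
    by rewrite /wd !ge_min !lexx orbT.
  split=> [v|v|||].
  - exact: cvx.
  - exact: cvx.
  - rewrite /mass !big_split -!mulr_sumr !sumrB /= -!/(mass _).
    have -> : mass p + z * (mass p' - mass p) + (mass q + z * (mass q' - mass q))
      = (1 - z) * (mass p + mass q) + z * (mass p' + mass q') by ring.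
    by rewrite m m'; ring.
  - split.
      have := ler_wpM2r (ltW kR) (ler_norm (- (t * z))); rewrite normrN; lra.
    have := ler_wpM2r (ltW SR) (ler_norm (t * z)); lra.
  - move: c_z; rewrite cz subr_ge0; congr (_ <= ksum _ _ _).
    by apply/funext => v; rewrite /w /w'; ring.
have := defect_deriv fp pmin e0 c0 _ feasz.
rewrite dc pmulr_rgt0 // => /(_ ep0).
rewrite -/u -/N -[t * S%:R * _]/(t * S%:R * N) tE.
have -> : (ep - Sg) / (X - rest X) * N = mu * ep - mu * Sg by rewrite /mu; ring.
move: epE; lra.
Qed.

(** p + q and the edge constraint stay fixed, and so does X; this serves the boundary case, where X
    has no room to move. *)
Lemma kkt_swap p q X p' q' : feas p q X ->
  (forall p' q' X', feas p' q' X' -> defect p X <= defect p' X') ->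
  (forall v, 0 <= p' v) -> (forall v, 0 <= q' v) ->
  (forall v, p' v + q' v = p v + q v) ->
  0 <= \sum_v (p' v - p v) * dg p v
     - (S%:R * X + slope * over (mass p) X) * (mass p' - mass p).
Proof.
move=> fp pmin p'0 q'0 E; have [p0 q0 m Xb T] := fp.
have c0 : 0 <= ('X : {poly R}).[0] by rewrite hornerX.
have dc : 0 < (deriv ('X : {poly R})).[0] by rewrite derivX hornerC.
suff feasz z : 0 < z < 1 -> 0 <= ('X : {poly R}).[z] ->
    feas (fun v => p v + z * (p' v - p v)) (fun v => q v + z * (q' v - q v)) (X + 0 * z).
  by have := defect_deriv fp pmin ltr01 c0 dc feasz; rewrite !mul0r addr0.
move=> /andP[z0 z1] _.
have cvx (b d : R) : 0 <= b -> 0 <= d -> 0 <= b + z * (d - b).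
  move=> b0 d0; have -> : b + z * (d - b) = (1 - z) * b + z * d by ring.
  by rewrite addr_ge0 // mulr_ge0 ?subr_ge0 // ltW.
have wE v : p v + z * (p' v - p v) + (q v + z * (q' v - q v)) = p v + q v.
  have -> : p v + z * (p' v - p v) + (q v + z * (q' v - q v))
    = (1 - z) * (p v + q v) + z * (p' v + q' v) by ring.
  by rewrite E; ring.
rewrite mul0r addr0; split=> // [v|v||].
- exact: cvx.
- exact: cvx.
- rewrite -m /mass -!big_split; apply: eq_bigr => v _; exact: wE.
- by move: T; congr (_ <= ksum _ _ _); apply/funext => v; rewrite wE.
Qed.

(* If b and b' are not adjacent, moving the weight of b' to b preserves feasibility. *)
Lemma supp_clique p q X b b' : feas p q X ->
  (forall q', feas p q' X -> (#|[pred v | q v != 0%R]| <= #|[pred v | q' v != 0%R]|)%N) ->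
  q b != 0 -> q b' != 0 -> b != b' ->
  dg (fun v => p v + q v) b = dg (fun v => p v + q v) b' -> G b b'.
Proof.
move=> [p0 q0 m Xb T] qmin qb qb' bb' dd; apply: contraT => nadj.
have abb' : a b b' = 0 by rewrite /adjw (negPf nadj).
pose h v : R := q b' * ((v == b)%:R - (v == b')%:R).
have hE f : \sum_v h v * f v = q b' * (f b - f b').
  rewrite /h; under eq_bigr do rewrite -mulrA mulrBl.
  by rewrite -mulr_sumr sumrB !sum_delta.
have hb' : q b' + h b' = 0 by rewrite /h eqxx eq_sym (negPf bb') sub0r mulrN1 subrr.
have hb : h b = q b' by rewrite /h eqxx (negPf bb') subr0 mulr1.
have hv v : v != b -> v != b' -> h v = 0.
  by rewrite /h => /negPf-> /negPf->; rewrite subr0 mulr0.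
have f' : feas p (fun v => q v + h v) X.
  split=> // [v||].
  - have [->|vb'] := eqVneq v b'; first by rewrite hb'.
    have [->|vb] := eqVneq v b; first by rewrite hb addr_ge0.
    by rewrite hv // addr0.
  - rewrite /mass big_split /= -!/(mass _) addrA m.
    have -> : mass h = \sum_v h v * 1 by apply: eq_bigr => v _; rewrite mulr1.
    by rewrite hE subrr mulr0 addr0.
  - have -> : (fun v => p v + (q v + h v)) = (fun v => (p v + q v) + h v).
      by apply/funext => v; rewrite addrA.
    rewrite ksum2D // hE dd subrr !mulr0 addr0 (ksum2_wdeg _ h) hE /wdeg !hE.
    by rewrite !avv (a_sym b' b) abb'; move: T; congr (_ <= _); ring.
have := qmin _ f'; rewrite leqNgt => /negP; case; apply: proper_card.
apply/properP; split; last by exists b'; rewrite !inE ?hb' ?eqxx.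
apply/fintype.subsetP => v; rewrite !inE; apply: contraNneq => qv0.
have vb' : v != b' by apply: contraNneq qb' => <-; rewrite qv0.
have vb : v != b by apply: contraNneq qb => <-; rewrite qv0.
by rewrite qv0 hv // addr0.
Qed.

(** Q is a largest clique in the support of p. Together with B it is still a clique, and every
    vertex of the support is non-adjacent to some member of Q, possibly itself. *)
Lemma clique_cover p (B : {set V}) : (forall v, 0 <= p v) -> clique G B ->
  (forall v b, p v != 0 -> b \in B -> G v b) ->
  exists Q : {set V}, [/\ {in Q, forall v, p v != 0}, (#|Q| + #|B| <= S + j)%N
    & mass p <= \sum_(v in Q) (mass p - dg p v)].
Proof.
move=> p0 /cliqueP cB pB.
pose ok (Q : {set V}) := clique G Q && [forall v in Q, p v != 0].
have ok0 : ok finset.set0.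
  apply/andP; split; first by apply/cliqueP => u v; rewrite finset.in_set0.
  by apply/forall_inP => v; rewrite finset.in_set0.
case: (arg_maxnP (fun Q : {set V} => #|Q|) ok0) => Q /andP[cQ /forall_inP pQ] Qmax.
exists Q; split=> //.
  have disj : [disjoint Q & B].
    rewrite disjoint_subset; apply/fintype.subsetP => v vQ; apply/negP => vB.
    by have := pB v v (pQ v vQ) vB; rewrite (adj_irr G).
  have [_] := leq_card_setU Q B; rewrite disj => /eqP <-.
  apply: kfree; apply/cliqueP => u v; rewrite !inE.
  move=> /orP[uQ|uB] /orP[vQ|vB] uv; [| | |exact: cB].
  - by move/cliqueP: cQ; apply.
  - by apply: pB => //; exact: pQ.
  - by rewrite (adj_sym G); apply: pB => //; exact: pQ.
have -> : \sum_(v in Q) (mass p - dg p v) = \sum_u p u * \sum_(v in Q) (1 - a v u).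
  under [RHS]eq_bigr do rewrite mulr_sumr.
  rewrite exchange_big; apply: eq_bigr => v _; rewrite /mass -sumrB.
  by apply: eq_bigr => u _; ring.
apply: ler_sum => u _; rewrite -[leLHS]mulr1.
have [->|pu] := eqVneq (p u) 0; first by rewrite !mul0r.
rewrite ler_wpM2l //.
have ge0 v : 0 <= 1 - a v u by have /andP[_] := a01 v u; rewrite subr_ge0.
suff [v vQ avu] : exists2 v, v \in Q & a v u = 0.
  rewrite (bigD1 v) //= avu subr0 lerDl; exact: sumr_ge0.
have [uQ|uQ] := boolP (u \in Q); first by exists u.
have [/forall_inP adjQ|/forall_inPn[v vQ nuv]] := boolP [forall v in Q, G u v]; last first.
  by exists v => //; rewrite a_sym /adjw (negPf nuv).
have okU : ok (u |: Q).
  rewrite /ok cliqueU1 // cQ /=; apply/andP; split; first exact/forall_inP.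
  by apply/forall_inP => v; rewrite !inE => /predU1P[->//|]; exact: pQ.
by have := Qmax _ okU; rewrite /= cardsU1 uQ add1n ltnn.
Qed.

(** * Contradiction at a minimiser with negative defect *)

Section AtMinimum.
Variables (p q : V -> R) (X : R).
Hypothesis fp : feas p q X.
Hypothesis pmin : forall p' q' X', feas p' q' X' -> defect p X <= defect p' X'.
Hypothesis qmin : forall q', feas p q' X ->
  (#|[pred v | q v != 0%R]| <= #|[pred v | q' v != 0%R]|)%N.
Hypothesis def_lt0 : defect p X < 0.

Local Notation w := (fun v => p v + q v).
Local Notation al := (mass p).
Local Notation Y := (rest X).
Local Notation u := (over al X).
(** z is the mass of p beyond S parts of weight X; g is half the derivative of [sbound] in the mass
    of p. *)
Let z := al - S%:R * X.
Let g := S%:R * X + slope * u.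

Let p0 v : 0 <= p v. Proof. by case: fp. Qed.
Let q0 v : 0 <= q v. Proof. by case: fp. Qed.
Let mpq : al + mass q = 1. Proof. by case: fp. Qed.
Let T2w : dens X <= T2 w. Proof. by case: fp. Qed.
Let dwE v : dg w v = dg p v + dg q v.
Proof. by rewrite /wdeg -big_split; apply: eq_bigr => b _; rewrite mulrDl. Qed.

Let SX_lt1 : S%:R * X < 1.
Proof.
have [_ _ _ [_ h] _] := fp; rewrite lt_neqAle h andbT; apply/eqP => E.
by move: def_lt0; rewrite ltNge (defect_ge0_rest0 fp E).
Qed.

Let Y_gt0 : 0 < Y. Proof. by rewrite divr_gt0 // subr_gt0. Qed.

Let kX_ge1 : 1 <= (S + j)%:R * X. Proof. by case: fp => _ _ _ []. Qed.
Let X_gt0 : 0 < X. Proof. by rewrite -(pmulr_rgt0 _ kR) (lt_le_trans ltr01). Qed.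

Let YX : Y <= X.
Proof. by rewrite -(ler_pM2l jR) restE; move: kX_ge1; rewrite natrD; lra. Qed.

Let mqE : mass q = j%:R * Y - z.
Proof. by rewrite restE /z -mpq; ring. Qed.

Let T2p : T2 p < bound al X + slope * u ^+ 2.
Proof. by have := def_lt0; rewrite /defect subr_lt0. Qed.

(* Split the sum according to adjacency to b. *)
Let two_groups b : (forall v, p v != 0 -> al - X <= dg p v) ->
  (forall v, p v != 0 -> a v b = 0 -> dg p v = g) -> dg p b = g ->
  (al - g) * g + g * (al - X) <= T2 p.
Proof.
move=> hall hmiss db.
have E : \sum_v p v * (1 - a b v) = al - g.
  by rewrite -db /mass /wdeg -sumrB; apply: eq_bigr => v _; ring.
have -> : (al - g) * g + g * (al - X)
  = \sum_v p v * ((1 - a b v) * g + a b v * (al - X)).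
  have -> : \sum_v p v * ((1 - a b v) * g + a b v * (al - X))
     = (\sum_v p v * (1 - a b v)) * g + dg p b * (al - X).
    by rewrite /wdeg !mulr_suml -big_split; apply: eq_bigr => v _ /=; ring.
  by rewrite E db.
rewrite ksum2_wdeg; apply: ler_sum => v _.
have [->|pv] := eqVneq (p v) 0; first by rewrite !mul0r.
rewrite ler_wpM2l //; have [abv|abv] := boolP (G b v).
  by rewrite /adjw abv subrr mul0r add0r mul1r; exact: hall.
have avb : a v b = 0 by rewrite a_sym /adjw (negPf abv).
by rewrite a_sym avb subr0 mul1r mul0r addr0 (hmiss v pv avb).
Qed.

Let dq_le v : dg q v <= mass q.
Proof. by apply: ler_sum => b _; rewrite ler_piMr //; have /andP[] := a01 v b. Qed.

Let dq_miss v b : a v b = 0 -> dg q v <= mass q - q b.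
Proof.
move=> avb; rewrite /wdeg /mass (bigD1 b) //= avb mulr0 add0r (bigD1 (P := predT) b) //=.
rewrite [leRHS]addrC addKr; apply: ler_sum => v' _; rewrite ler_piMr //.
by have /andP[] := a01 v v'.
Qed.

Let full_deg (f : V -> R) v : (forall b, f b != 0 -> a v b = 1) -> dg f v = mass f.
Proof.
move=> h; apply: eq_bigr => b _; have [->|fb] := eqVneq (f b) 0; first by rewrite mul0r.
by rewrite h // mulr1.
Qed.

Let eqw D : (forall v, dg w v <= D) -> T2 w = D -> forall v, w v != 0 -> dg w v = D.
Proof.
move=> le E v wv; have m1 : mass w = 1 by rewrite /mass big_split.
have w0 b : 0 <= w b by rewrite addr_ge0.
have : \sum_b w b * (D - dg w b) = 0.
  under eq_bigr do rewrite mulrBr.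
  by rewrite sumrB -mulr_suml -/(mass w) m1 mul1r -ksum2_wdeg E subrr.
move/psumr_eq0P => /(_ (fun b _ => mulr_ge0 (w0 b) (etrans (subr_ge0 _ _) (le b)))).
by move=> /(_ v isT)/eqP; rewrite mulf_eq0 (negPf wv) /= subr_eq0 => /eqP.
Qed.

Let supp_pos v : p v != 0 -> 0 < p v. Proof. by move=> h; rewrite lt_neqAle eq_sym h p0. Qed.
Let supq_pos v : q v != 0 -> 0 < q v. Proof. by move=> h; rewrite lt_neqAle eq_sym h q0. Qed.

Let B : {set V} := [set v | q v != 0].

Let clique_B D : (forall b, q b != 0 -> dg w b = D) -> clique G B.
Proof.
move=> h; apply/cliqueP => b b'; rewrite !inE => qb qb' bb'.
by apply: (supp_clique fp qmin qb qb' bb'); rewrite !h.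
Qed.

Let dq_supp b : clique G B -> q b != 0 -> dg q b = mass q - q b.
Proof.
move=> /cliqueP cB qb; rewrite /wdeg /mass (bigD1 b) //= avv mulr0 add0r.
rewrite [in RHS](bigD1 b) //= [RHS]addrC addKr; apply: eq_bigr => b' b'b.
have [->|qb'] := eqVneq (q b') 0; first by rewrite mul0r.
by rewrite /adjw cB ?inE // ?mulr1 // eq_sym.
Qed.

Let mass_delta b : mass (fun v : V => (v == b)%:R : R) = 1.
Proof. by rewrite /mass -[RHS](sum_delta b (fun=> 1)); apply: eq_bigr => v _; rewrite mulr1. Qed.

Let sum_deltaB (f h : V -> R) b :
  \sum_v ((v == b)%:R - f v) * h v = h b - \sum_v f v * h v.
Proof. by under eq_bigr do rewrite mulrBl; rewrite sumrB sum_delta. Qed.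

Let u_small : z <= Y -> u = 0.
Proof. by move=> zY; rewrite /over max_l // /excess -/z subr_le0. Qed.

Let u_large : Y <= z -> u = z - Y.
Proof. by move=> zY; rewrite /over max_r // /excess -/z subr_ge0. Qed.

Let SS_X : S.+1%:R * X = S%:R * X + X. Proof. by rewrite -natr1; ring. Qed.

Let boundE : bound al X = z * (S%:R * X) + S%:R * X * (al - X).
Proof. by rewrite /bound SS_X /z; ring. Qed.

Let dichotomy v :
  (exists2 b, q b != 0 & a v b = 0) \/ (forall b, q b != 0 -> a v b = 1).
Proof.
have [/existsP[b /andP[qb avb]]|/existsPn none] := boolP [exists b, (q b != 0) && ~~ G v b].
  by left; exists b => //; rewrite /adjw (negPf avb).
by right=> b qb; move: (none b); rewrite qb /= negbK /adjw => ->.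
Qed.

Let T2_const c : (forall v, p v != 0 -> dg p v = c) -> T2 p = al * c.
Proof.
move=> h; rewrite ksum2_wdeg mulr_suml; apply: eq_bigr => v _.
by have [->|pv] := eqVneq (p v) 0; rewrite ?mul0r // h.
Qed.

Let massq_const c : (forall b, q b != 0 -> q b = c) -> mass q = #|B|%:R * c.
Proof.
move=> h; rewrite /mass (bigID (mem B)) /= [X in _ + X]big1 ?addr0; last first.
  by move=> b; rewrite inE negbK => /eqP.
rewrite [RHS]mulr_natl -sumr_const; apply: eq_bigr => b; rewrite inE; exact: h.
Qed.

(* Here p + q attains Turan's bound, hence maximises the edge sum, so that all vertices
   of its support have the same degree. *)
Lemma boundary_absurd : (S + j)%:R * X = 1 -> False.
Proof.
move=> kX; have YE : Y = X.
  by apply: (mulfI (lt0r_neq0 jR)); rewrite restE; move: kX; rewrite natrD; lra.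
have densE : dens X = 1 - X.
  rewrite /dens YE -addrA -opprD -mulrDl -natrD expr2 mulrA kX mul1r //.
have turan f : (forall v, 0 <= f v) -> mass f = 1 -> T2 f <= 1 - X.
  move=> f0 m; have := turan_density aw f0 m (ksum_cliquefree f kfree (leqnn _)).
  by rewrite -[X in _ -> _ <= X](mulKf (lt0r_neq0 kR)) mulrBr mulr1 kX ler_pdivlMl.
have w0 v : 0 <= w v by rewrite addr_ge0.
have m1 : mass w = 1 by rewrite /mass big_split.
have T2wE : T2 w = 1 - X by apply/le_anti; rewrite turan //= -densE.
(* Moving weight towards v cannot exceed Turan's maximum. *)
have dle v : dg w v <= 1 - X.
  pose f := - seg_ksum a a w (fun b => (b == v)%:R) 2.
  have := @constrained_min_deriv_ge0 R f 'X 1 ltr01; rewrite derivX hornerX hornerC.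
  rewrite /f derivN !hornerN seg_ksum_deriv0 // dksum2 // sum_deltaB.
  rewrite -ksum2_wdeg T2wE seg_ksum_at0 T2wE => h.
  suff : 0 <= - (2 * (dg w v - (1 - X))) by lra.
  apply: h => // t /andP[t0 t1] _; rewrite hornerN lerN2 seg_ksum_at.
  have -> : (fun b c : V => a b c + t * (a b c - a b c)) = a.
    by apply/funext => b; apply/funext => c; rewrite subrr mulr0 addr0.
  apply: turan => [b|].
    have -> : w b + t * ((b == v)%:R - w b) = (1 - t) * w b + t * (b == v)%:R by ring.
    by rewrite addr_ge0 // mulr_ge0 ?ler0n ?subr_ge0 // ltW.
  by rewrite /mass big_split -mulr_sumr sumrB /= -!/(mass _) mass_delta m1; ring.
have dwE' := eqw dle T2wE.
have pw v : p v != 0 -> dg w v = 1 - X.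
  by move/supp_pos => h; apply: dwE'; rewrite gt_eqF // ltr_pwDl.
have qw v : q v != 0 -> dg w v = 1 - X.
  by move/supq_pos => h; apply: dwE'; rewrite gt_eqF // ltr_wpDl.
have cB := clique_B qw.
(* Shift the weight e at v from q to p. *)
have swap e v : 0 <= p v + e -> 0 <= q v - e -> 0 <= e * (dg p v - g).
  move=> h1 h2; have dE (f : V -> R) c : \sum_b (f b + e * (b == v)%:R - f b) * c b = e * c v.
    rewrite -(sum_delta v c) mulr_sumr; apply: eq_bigr => b _; ring.
  have := kkt_swap (p' := fun b => p b + e * (b == v)%:R)
    (q' := fun b => q b - e * (b == v)%:R) fp pmin.
  rewrite dE -/g; have -> : mass (fun b => p b + e * (b == v)%:R) - al = e.
    rewrite /mass -sumrB; have := dE p (fun=> 1); rewrite mulr1 => dE1.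
    by rewrite -[RHS]dE1; apply: eq_bigr => b _; rewrite mulr1.
  have -> : e * dg p v - g * e = e * (dg p v - g) by ring.
  apply=> [b|b|b]; [| |ring].
    by have [->|] := eqVneq b v; rewrite /= ?mulr1n ?mulr1 // mulr0n mulr0 addr0.
  by have [->|] := eqVneq b v; rewrite /= ?mulr1n ?mulr1 // mulr0n mulr0 subr0.
have pg v : p v != 0 -> dg p v <= g.
  move=> pv; have := swap (- p v) v; rewrite subrr lexx opprK addr_ge0 // => /(_ isT isT).
  by rewrite mulNr oppr_ge0 pmulr_rle0 ?supp_pos // subr_le0.
have qg v : q v != 0 -> g <= dg p v.
  move=> qv; have := swap (q v) v; rewrite subrr lexx addr_ge0 // => /(_ isT isT).
  by rewrite pmulr_rge0 ?supq_pos // subr_ge0.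
(* The q-degree of v falls short of mass q by at least q b, that of b by exactly q b; as the total
   degrees agree, g >= dg p v >= dg p b >= g. *)
have miss v b : p v != 0 -> q b != 0 -> a v b = 0 -> dg p v = g /\ dg p b = g.
  move=> pv qb avb; have := dq_miss avb; have := pg v pv; have := qg b qb.
  have := pw v pv; have := qw b qb; rewrite !dwE (dq_supp cB qb).
  by move=> *; split; lra.
have nomiss v : p v != 0 -> (forall b, q b != 0 -> a v b = 1) -> dg p v = al - X.
  move=> pv adj; have := pw v pv; rewrite dwE (full_deg adj); have := mpq; lra.
have z_le : z <= j%:R * X.
  rewrite -YE; have := mqE; have : 0 <= mass q by apply: sumr_ge0. lra.
have [alg eu u2] : [/\ al - X <= g, slope * u <= X + u
    & slope * u ^+ 2 <= slope * u * (2 * z - X - slope * u)].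
  have [zY|zY] := leP z Y.
    rewrite /g u_small // expr0n !(mulr0, mul0r, addr0); move: zY; rewrite YE /z.
    by move=> ?; split=> //; [lra | exact: ltW].
  have uE := u_large (ltW zY); have zX : X < z by rewrite -{1}YE.
  have j1 : (1 < j)%N.
    rewrite ltn_neqAle j0 andbT eq_sym; apply/eqP => j1.
    by move: z_le; rewrite j1 mul1r leNgt zX.
  have j10 : 0 < j%:R - 1 :> R by rewrite subr_gt0 ltr1n.
  have uX : u = z - X by rewrite uE YE.
  have u0 : 0 < u by rewrite uX subr_gt0.
  have eE : (slope * u - u) * (j%:R - 1) = u.
    by rewrite mulrBl mulrAC slopeE //; ring.
  have e1 : u <= slope * u by rewrite -subr_ge0 -(pmulr_lge0 _ j10) eE ltW.
  have e2 : slope * u <= X + u.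
    rewrite -lerBlDr -(ler_pM2r j10) eE uX; move: z_le; lra.
  split=> //; first by move: e1; rewrite /g uX /z; lra.
  rewrite expr2 mulrA ler_wpM2l //; first by rewrite mulr_ge0 // ltW.
  by move: e2; rewrite uX; lra.
have := T2p; apply/negP; rewrite -leNgt.
have [/existsP[v /existsP[b /and3P[pv qb /eqP avb]]]|none] :=
    boolP [exists v, exists b, [&& p v != 0, q b != 0 & a v b == 0]].
  have [_ db] := miss v b pv qb avb.
  apply: le_trans (two_groups _ _ db).
  - rewrite boundE.
    have -> : (al - g) * g + g * (al - X) = z * (S%:R * X) + S%:R * X * (al - X)
       + slope * u * (2 * z - X - slope * u) by rewrite /g /z; ring.
    by rewrite lerD2l.
  - move=> v' pv'; case: (dichotomy v') => [[b' qb' h]|/(nomiss v' pv')->//].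
    by have [-> _] := miss v' b' pv' qb' h.
  - by move=> v' pv' h; case: (miss v' b pv' qb h).
have full v b : p v != 0 -> q b != 0 -> a v b = 1.
  move=> pv qb; case: (dichotomy v) => [[b' qb' h]|]; last exact.
  by case/negP: none; apply/existsP; exists v; apply/existsP; exists b'; rewrite pv qb' h eqxx.
have qX b : q b != 0 -> q b = X.
  move=> qb; have := qw b qb; rewrite dwE (dq_supp cB qb) full_deg; last first.
    by move=> v pv; rewrite a_sym full.
  have := mpq; lra.
rewrite (T2_const (c := al - X)); last by move=> v pv; apply: nomiss => // b; exact: full.
have mq := massq_const qX.
rewrite boundE; have -> : al * (al - X) = z * (S%:R * X) + S%:R * X * (al - X) + z * (z - X).
  by rewrite /z; ring.
rewrite lerD2l; have [zY|zY] := leP z Y; last first.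
  have uX : u = z - X by rewrite u_large ?(ltW zY) // YE.
  rewrite -uX expr2 mulrA ler_wpM2r //; last by move: eu; rewrite uX; lra.
  by rewrite uX subr_ge0 -YE ltW.
rewrite u_small // expr0n mulr0; move: mq; rewrite mqE YE => mq; rewrite YE in zY.
(* z = (j - #|B|) X is an integer multiple of X, so z (z - X) is never negative. *)
have [jB|Bj] := leqP j #|B|.
  have z0 : z <= 0.
    have : j%:R * X <= #|B|%:R * X by rewrite ler_pM2r // ler_nat.
    lra.
  by apply: mulr_le0 => //; rewrite subr_le0.
have zX : X <= z.
  have : #|B|.+1%:R * X <= j%:R * X by rewrite ler_pM2r // ler_nat.
  by rewrite -natr1 mulrDl; lra.
by have -> : z = X; [apply/le_anti/andP | rewrite subrr mulr0].
Qed.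

(** D is the degree in p + q on the support of q, and bounds all degrees. If Y <= z, the multiplier
    mu is 1 and a vertex of supp p would have q-degree D - g, more than the mass of q. If z < Y,
    then mu > 1 and D > 1 - Y. A non-adjacent pair between the supports is excluded by [two_groups].
    Otherwise B is joined to supp p and has at least j vertices, which leaves at most S for a clique
    Q of supp p; these are too few to cover the mass of p. *)
Lemma interior_absurd : 1 < (S + j)%:R * X -> False.
Proof.
move=> kX; have XY : 0 < X - Y.
  by rewrite -(pmulr_rgt0 _ jR) mulrBr restE; move: kX; rewrite natrD; lra.
have mq0 : 0 <= mass q by apply: sumr_ge0.
have [mu [muE mu0]] : exists mu, mu * (X - Y) = X - z + u /\ 0 < mu.
  exists ((X - z + u) / (X - Y)); rewrite divfK ?gt_eqF //; split=> //.
  rewrite divr_gt0 //; have [zY|zY] := leP z Y; first by rewrite u_small //; lra.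
  by rewrite (u_large (ltW zY)); lra.
have m1 : mass w = 1 by rewrite /mass big_split.
have w0 v : 0 <= w v by rewrite addr_ge0.
have kktE p' q' : (forall v, 0 <= p' v) -> (forall v, 0 <= q' v) -> mass p' + mass q' = 1 ->
    mu * (\sum_v (p' v + q' v) * dg w v - T2 w)
    <= \sum_v p' v * dg p v - T2 p - g * (mass p' - al).
  move=> p'0 q'0 m'; have := kkt fp pmin kX SX_lt1 p'0 q'0 m'.
  have -> : (X - (al - S%:R * X) + u) / (X - Y) = mu by rewrite -/z -muE mulfK ?gt_eqF.
  rewrite -/g; congr (_ * _ <= _ - _).
    by rewrite ksum2_wdeg -sumrB; apply: eq_bigr => v _; rewrite mulrBl.
  by rewrite ksum2_wdeg -sumrB; apply: eq_bigr => v _; rewrite mulrBl.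
have [D DE] : exists D, mu * D = mu * T2 w + g * al - T2 p.
  by exists ((mu * T2 w + g * al - T2 p) / mu); rewrite mulrC divfK // gt_eqF.
have mass0 : mass (fun _ : V => 0 : R) = 0 by rewrite /mass big1.
have dw_le v : dg w v <= D.
  have := kktE (fun=> 0) (fun b => (b == v)%:R) (fun=> lexx 0) (fun=> ler0n _ _).
  rewrite mass0 mass_delta add0r => /(_ erefl).
  rewrite (eq_bigr (fun b => (b == v)%:R * dg w b)); last by move=> b _; rewrite add0r.
  rewrite sum_delta big1 ?add0r; last by move=> b _; rewrite mul0r.
  by move=> h; rewrite -(ler_pM2l mu0) DE; move: h; lra.
have dp_ge v : mu * (dg w v - D) <= dg p v - g.
  have := kktE (fun b => (b == v)%:R) (fun=> 0) (fun=> ler0n _ _) (fun=> lexx 0).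
  rewrite mass0 mass_delta addr0 => /(_ erefl).
  rewrite (eq_bigr (fun b => (b == v)%:R * dg w b)); last by move=> b _; rewrite addr0.
  by rewrite !sum_delta => h; rewrite mulrBr DE; move: h; lra.
(* Complementary slackness: the choice of D makes these nonnegative terms sum to 0. *)
have avg : \sum_v (q v * (mu * (D - dg w v)) + p v * (dg p v - g - mu * (dg w v - D))) = 0.
  rewrite (eq_bigr (fun v => mu * D * (p v + q v) - mu * ((p v + q v) * dg w v)
    + (p v * dg p v - g * p v))); last by move=> v _; ring.
  rewrite big_split !sumrB -!mulr_sumr -!ksum2_wdeg /=.
  have -> : \sum_v (p v + q v) = 1 by rewrite big_split.
  by rewrite mulr1 DE -/(mass p); ring.
have ge0q v : 0 <= q v * (mu * (D - dg w v)).
  by rewrite mulr_ge0 // mulr_ge0 ?subr_ge0 // ltW.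
have ge0p v : 0 <= p v * (dg p v - g - mu * (dg w v - D)).
  by rewrite mulr_ge0 // subr_ge0.
have eq0 v : q v * (mu * (D - dg w v)) = 0 /\ p v * (dg p v - g - mu * (dg w v - D)) = 0.
  have /psumr_eq0P := avg => /(_ (fun b _ => addr_ge0 (ge0q b) (ge0p b)) v isT)/eqP.
  by rewrite paddr_eq0 // => /andP[/eqP-> /eqP->].
have qD v : q v != 0 -> dg w v = D.
  move=> qv; have [/eqP] := eq0 v; rewrite !mulf_eq0 (negPf qv) (gt_eqF mu0) /=.
  by rewrite subr_eq0 => /eqP.
have pD v : p v != 0 -> dg p v = g + mu * (dg w v - D).
  move=> pv; have [_ /eqP] := eq0 v; rewrite mulf_eq0 (negPf pv) subr_eq0 /= => /eqP; lra.
have T2w' : mu * dens X <= mu * T2 w by rewrite ler_wpM2l // ltW.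
have alE : al = S%:R * X + z by rewrite /z; ring.
have jY := restE X.
have [Yz|zY] := leP Y z.
  have uE := u_large Yz.
  have mu_1 : mu = 1 by apply: (mulIf (lt0r_neq0 XY)); rewrite muE uE; ring.
  have e_u : j%:R * u = slope * u * (j%:R - 1).
    have [j1|j1] := ltnP 1 j; first by rewrite mulrAC slopeE.
    have {}j1 : j = 1%N by apply/eqP; rewrite eqn_leq j1.
    suff -> : u = 0 by rewrite !mulr0 mul0r.
    by apply: u_small; move: mq0; rewrite mqE j1; lra.
  have key : dens X + g * al - (bound al X + slope * u ^+ 2) = g + mass q.
    apply/eqP; rewrite -subr_eq0 boundE mqE /dens /g; apply/eqP.
    move: e_u jY uE alE; set e := slope * u; rewrite -[u]/(over al X).
    have -> : slope * over al X ^+ 2 = e * over al X by rewrite /e; ring.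
    move: (over al X) z (rest X) e => u' z' Y' e e_u jY uE ->.
    have -> : z' = u' + Y' by rewrite uE; ring.
    transitivity (Y' * (j%:R * u' - e * (j%:R - 1))
      + (1 - S%:R * X - j%:R * Y') * (1 + Y' + u' - e)); first by ring.
    by rewrite e_u jY; ring.
  have Dg : mass q < D - g.
    by have := T2p; move: DE T2w'; rewrite mu_1 !mul1r; lra.
  have [/existsP[v pv]|/existsPn none] := boolP [exists v, p v != 0].
    by have := dq_le v; have := pD v pv; have := dwE v; rewrite mu_1; lra.
  have al0 : al = 0.
    by rewrite /mass big1 // => v _; have := none v; rewrite negbK => /eqP.
  have Z0 := lt_le_trans Y_gt0 Yz; have := addr_gt0 (mulr_gt0 SR X_gt0) Z0.
  by rewrite -alE al0 ltxx.
have u0 := u_small (ltW zY); have gE : g = S%:R * X by rewrite /g u0 mulr0 addr0.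
rewrite u0 addr0 in muE.
have D_gt : 1 - Y < D.
  rewrite -(ltr_pM2l mu0) DE; have := T2p; rewrite u0 expr0n mulr0 addr0 boundE gE.
  have : mu * (1 - Y) = mu * dens X + S%:R * X * (X - z).
    rewrite -muE /dens; have -> : 1 - Y = 1 - S%:R * X ^+ 2 - j%:R * Y ^+ 2 + S%:R * X * X
      + (j%:R * Y) * Y - Y by ring.
    rewrite restE; ring.
  by rewrite alE; move: T2w'; lra.
have mu1 : (mu - 1) * (X - Y) = Y - z by rewrite mulrBl muE; ring.
have mu_gt1 : 0 < mu - 1 by rewrite -(pmulr_lgt0 _ XY) mu1 subr_gt0.
have cB := clique_B qD.
have qp_ge b : q b != 0 -> g <= dg p b.
  by move=> /qD E; have := dp_ge b; rewrite E subrr mulr0 subr_ge0.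
(* Comparing the degrees of v and b leaves (mu - 1) (D - dg w v) <= 0, so v too has degree D. *)
have miss v b : p v != 0 -> q b != 0 -> a v b = 0 -> dg p v = g /\ dg p b = g.
  move=> pv qb avb; have := dq_miss avb; have := qp_ge b qb; have := qD b qb.
  have := pD v pv; rewrite [dg w b]dwE (dq_supp cB qb).
  have := dwE v; have := dw_le v; rewrite -subr_ge0 => /(mulr_ge0 (ltW mu_gt1)) h.
  move=> dv pv' db gb qv; have h0 : (mu - 1) * (D - dg w v) = 0.
    by apply/le_anti; rewrite h andbT; move: pv' qv db gb; rewrite dv; lra.
  split; last by move: h0 pv' qv db gb; rewrite dv; lra.
  move/eqP: h0; rewrite mulf_eq0 (gt_eqF mu_gt1) /= subr_eq0 => /eqP DD.
  by move: pv'; rewrite DD subrr mulr0 addr0.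
have nomiss v : p v != 0 -> (forall b, q b != 0 -> a v b = 1) -> al - X < dg p v.
  move=> pv adj; have := pD v pv; have := dwE v; rewrite (full_deg adj) => dv pv'.
  have : (mu - 1) * (D - dg w v) < (mu - 1) * (X - Y).
    by rewrite mu1; move: pv' D_gt mpq; rewrite alE gE dv; lra.
  by rewrite ltr_pM2l //; move: D_gt mpq; rewrite dv; lra.
have gX : al - X <= g by rewrite gE alE; lra.
have [/existsP[v /existsP[b /and3P[pv qb /eqP avb]]]|none] :=
    boolP [exists v, exists b, [&& p v != 0, q b != 0 & a v b == 0]].
  have [_ db] := miss v b pv qb avb.
  have := T2p; apply/negP; rewrite -leNgt u0 expr0n mulr0 addr0.
  apply: le_trans (two_groups _ _ db).
  - by rewrite boundE gE /z lerD2r.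
  - move=> v' pv'; case: (dichotomy v') => [[b' qb' h]|/(nomiss v' pv')/ltW//].
    by have [-> _] := miss v' b' pv' qb' h.
  - by move=> v' pv' h; case: (miss v' b pv' qb h).
have full v b : p v != 0 -> q b != 0 -> a v b = 1.
  move=> pv qb; case: (dichotomy v) => [[b' qb' h]|]; last exact.
  by case/negP: none; apply/existsP; exists v; apply/existsP; exists b'; rewrite pv qb' h eqxx.
have pB v b : p v != 0 -> b \in B -> G v b.
  rewrite inE => pv qb; have := full v b pv qb; rewrite /adjw.
  by case: (G v b) => // /eqP; rewrite eq_sym oner_eq0.
have [Q [pQ QB alQ]] := clique_cover p0 cB pB.
have dgB b : q b != 0 -> dg p b = al.
  by move=> qb; rewrite full_deg // => v pv; rewrite a_sym full.
have qDb b : q b != 0 -> q b = 1 - D.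
  by move=> qb; have := qD b qb; rewrite dwE dgB // (dq_supp cB qb); move: mpq; lra.
have mB := massq_const qDb.
(* Each vertex of B carries 1 - D < Y, while mass q = j Y - z exceeds (j - 1) Y. *)
have jB : (j <= #|B|)%N.
  rewrite leqNgt; apply/negP => Bj.
  have : #|B|%:R * (1 - D) <= #|B|%:R * Y by rewrite ler_wpM2l ?ler0n //; lra.
  have : #|B|.+1%:R * Y <= j%:R * Y by rewrite ler_pM2r // ler_nat.
  by rewrite -natr1 -mB mqE; lra.
have al_ge : S%:R * X <= al.
  have /card_gt0P[b] : (0 < #|B|)%N by exact: leq_trans jB.
  by rewrite inE => qb; rewrite -gE -(dgB b qb) qp_ge.
have QS : (#|Q| <= S)%N by rewrite -(leq_add2r j) (leq_trans _ QB) // leq_add2l.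
have SX0 := mulr_gt0 SR X_gt0.
have hasQ : has (mem Q) (index_enum V).
  apply: contraLR alQ => /hasPn h; rewrite -ltNge big1_seq ?(lt_le_trans SX0) // => v.
  by move=> /andP[vQ /h]; rewrite /= vQ.
have : \sum_(v in Q) (al - dg p v) < \sum_(v in Q) X.
  apply: ltr_sum => // v vQ; have pv := pQ v vQ.
  by have := nomiss v pv (fun b => full v b pv); lra.
rewrite sumr_const -mulr_natl => lt.
have : #|Q|%:R * X <= S%:R * X by rewrite ler_pM2r // ler_nat.
lra.
Qed.

End AtMinimum.

Theorem local_density p q X : feas p q X -> sbound (mass p) X <= T2 p.
Proof.
move=> f0; have [p1 [q1 [X1 [f1 pmin qmin]]]] := exists_min_defect f0.
rewrite -subr_ge0; apply: le_trans (pmin _ _ _ f0).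
rewrite leNgt; apply/negP => lt0; have [_ _ _ [kX _] _] := f1.
move: kX; rewrite le_eqVlt => /orP[/eqP|].
  by move/esym; exact: boundary_absurd f1 pmin qmin lt0.
exact: interior_absurd f1 pmin qmin lt0.
Qed.

End LocalDensity.

Lemma multi_bin (R : comNzRingType) s t (L m : R) : (0 < t)%N ->
  multi s t L m = t`!%:R *
    ('C(s, t)%:R * L ^+ t + 'C(s, t - 1)%:R * L ^+ (t - 1) * (m - s%:R * L)).
Proof.
case: t => // t _; rewrite /multi subSS subn0 ?succnK -!bin_ffact factS.
rewrite (natrM _ 'C(s, t.+1)) (natrM _ t.+1) (natrM _ 'C(s, t)); ring.
Qed.

(** * Counting copies *)

Section Copies.
Variables (R : realType) (V : finType) (G : sgraph V).
Implicit Types A B : {set V}.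

Lemma edges_Kcopies : edges G = Kcopies G [set: V]%SET 2.
Proof.
apply/setP => A; rewrite !inE finset.subsetT /=.
apply/existsP/andP => [[x /existsP[y /andP[xy /eqP->]]]|[/cards2P[x [y [xy ->]]] /cliqueP cA]].
  have xny : x != y by apply: contraTneq xy => ->; rewrite (adj_irr G).
  split; first by rewrite cards2 xny.
  apply/cliqueP => u v; rewrite !inE => /orP[]/eqP-> /orP[]/eqP->; rewrite ?eqxx // => _.
  by rewrite (adj_sym G).
exists x; apply/existsP; exists y; rewrite eqxx andbT; apply: cA => //; rewrite !inE eqxx ?orbT //.
Qed.

Lemma Kfree_card r A : (0 < r)%N -> Kfree G r -> clique G A -> (#|A| <= r.-1)%N.
Proof.
move=> r0 free /cliqueP cA; rewrite -ltnS prednK // ltnNge; apply/negP => rA.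
have /card_gt0P[B] : (0 < #|[set B : {set V} | (B \subset A) && (#|B| == r)]|)%N.
  by rewrite cards_draws bin_gt0.
rewrite inE => /andP[/fintype.subsetP BA Br].
suff : B \in Kcopies G [set: V]%SET r by rewrite free finset.in_set0.
rewrite inE finset.subsetT Br; apply/cliqueP => u v /BA uA /BA vA; exact: cA.
Qed.

Lemma ksum_indicator A t (c : R) :
  ksum (adjw R G) t (fun v => c * (v \in A)%:R) = t`!%:R * (c ^+ t * #|Kcopies G A t|%:R).
Proof.
rewrite ksum_clique; congr (_ * _).
rewrite -sum1_card natr_sum mulr_sumr big_mkcond [RHS]big_mkcond.
apply: eq_bigr => B _; rewrite inE.
have [cB|] := boolP (clique G B); last by rewrite !andbF.
have [/eqP Bt|] := boolP (#|B| == t); last by rewrite !andbF.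
rewrite !andbT; have [/fintype.subsetP BA|/fintype.subsetPn[v vB vA]] := boolP (B \subset A).
  rewrite mulr1 -Bt -prodr_const; apply: eq_bigr => v /BA->; exact: mulr1.
by rewrite (bigD1 v) //= (negPf vA) mulr0 mul0r.
Qed.

Lemma local_copies A S j t (al gam X L : R) : (0 < S)%N -> (0 < j)%N ->
  (forall B, clique G B -> (#|B| <= S + j)%N) -> (0 < #|V|)%N ->
  0 < al -> al * #|V|%:R <= #|A|%:R -> gam * #|V|%:R ^+ 2 <= #|edges G|%:R ->
  1 <= (S + j)%:R * X -> S%:R * X <= 1 -> dens S j X = 2 * gam ->
  S%:R * L <= al <= S.+1%:R * L -> multi S 2 L al <= sbound S j al X ->
  multi S t L al * #|V|%:R ^+ t <= t`!%:R * #|Kcopies G A t|%:R.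
Proof.
move=> S0 j0 kfree V0 al0 alA gE kX SX dX SL mL.
set n : R := #|V|%:R; have n0 : 0 < n by rewrite ltr0n.
have A0 : 0 < #|A|%:R :> R by apply: lt_le_trans alA; rewrite mulr_gt0.
(* Rounding may make A larger than al * n; the factor al / #|A| <= 1 / n gives p mass exactly al. *)
pose p v : R := al / #|A|%:R * (v \in A)%:R; pose q v := n^-1 - p v.
have pn : al / #|A|%:R <= n^-1.
  by rewrite ler_pdivrMr // mulrC ler_pdivlMr.
have p0 v : 0 <= p v by rewrite mulr_ge0 // divr_ge0 // ltW.
have p_le v : p v <= n^-1 * (v \in A)%:R by rewrite ler_wpM2r.
have q0 v : 0 <= q v.
  by rewrite subr_ge0 (le_trans (p_le v)) // ler_piMr ?invr_ge0 ?lern1 ?leq_b1 // ltW.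
have mp : mass p = al.
  have mA : \sum_v (v \in A)%:R = #|A|%:R :> R.
    rewrite -sum1_card natr_sum [RHS]big_mkcond; apply: eq_bigr => v _.
    by case: (v \in A).
  by rewrite /mass -mulr_sumr mA divfK // gt_eqF.
have mq : mass p + mass q = 1.
  rewrite /mass -big_split /= (eq_bigr (fun=> n^-1)) => [|v _]; last by rewrite /q; ring.
  by rewrite sumr_const -mulr_natl mulfV // gt_eqF.
have aw := adjw_weights R G.
have fpq : feas G S j p q X.
  split=> //; rewrite dX.
  have -> : (fun v => p v + q v) = (fun v => n^-1 * (v \in [set: V]%SET)%:R).
    by apply/funext => v; rewrite finset.in_setT mulr1 /q; ring.
  rewrite ksum_indicator -edges_Kcopies ler_pM2l // exprVn mulrC.
  by rewrite ler_pdivlMr ?exprn_gt0.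
have T2p := local_density S0 j0 kfree fpq.
have Tp := @clique_density R V S t (adjw R G) S0 aw p L p0.
rewrite mp in T2p Tp; have {}Tp := Tp SL (le_trans mL T2p).
have : multi S t L al <= t`!%:R * (n^-1 ^+ t * #|Kcopies G A t|%:R).
  rewrite -ksum_indicator (le_trans Tp) //; apply: ksum_mono => // v.
  by rewrite p0 p_le.
by rewrite exprVn mulrCA mulrC ler_pdivlMr ?exprn_gt0.
Qed.

End Copies.

(** * Part weights and the function d *)

Section PartWeights.
Variables (R : realType) (S j : nat).
Hypotheses (S0 : (0 < S)%N) (j0 : (0 < j)%N).
Local Notation K := ((S + j)%:R : R).
Implicit Types gam D al : R.

Let SR : 0 < S%:R :> R. Proof. by rewrite ltr0n. Qed.
Let jR : 0 < j%:R :> R. Proof. by rewrite ltr0n. Qed.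
Let K0 : 0 < K. Proof. by rewrite ltr0n addn_gt0 S0. Qed.

Lemma d_sqr gam : gam <= (K - 1) / (2 * K) ->
  d (S + j).+1 gam S.+1 ^+ 2 = 2 * S%:R * j%:R / K * ((K - 1) / (2 * K) - gam).
Proof.
move=> hg; rewrite /d.
have -> : (S + j).+1%:R - 1 = K :> R by rewrite -natr1; ring.
have -> : (S + j).+1%:R - 2 = K - 1 :> R by rewrite -natr1; ring.
have -> : (S + j).+1%:R - S.+1%:R = j%:R :> R by rewrite -!natr1 natrD; ring.
have -> : S.+1%:R - 1 = S%:R :> R by rewrite -natr1; ring.
rewrite sqr_sqrtr // mulr_ge0 ?subr_ge0 //.
by rewrite divr_ge0 // ?mulr_ge0 ?ler0n // ltW.
Qed.

Lemma rest_param D : rest S j (1 / K + D / S%:R) = 1 / K - D / j%:R.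
Proof. by rewrite /rest; move: SR jR K0; rewrite natrD => *; field; rewrite !gt_eqF. Qed.

(** The origin of d(s): among r - 1 = S + j parts, S = s - 1 equal large ones and j equal small
    ones, it is the total weight by which the large parts exceed S / (r - 1) when the edge sum is 2
    gamma. *)
Lemma dens_param gam D :
  D ^+ 2 = 2 * S%:R * j%:R / K * ((K - 1) / (2 * K) - gam) ->
  dens S j (1 / K + D / S%:R) = 2 * gam.
Proof.
move=> DE; rewrite /dens rest_param.
have -> : 1 - S%:R * (1 / K + D / S%:R) ^+ 2 - j%:R * (1 / K - D / j%:R) ^+ 2
    = 1 - 1 / K - D ^+ 2 * K / (S%:R * j%:R).
  by move: SR jR K0; rewrite natrD => *; field; rewrite !gt_eqF.
by rewrite DE; move: SR jR K0; rewrite natrD => *; field; rewrite !gt_eqF.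
Qed.

(** Here X enters through [dens] alone; for dens = 2 gamma this is twice the right-hand side of the
    equation in [is_L]. *)
Lemma sbound_large al X : (1 < j)%N -> 0 <= excess S j al X ->
  sbound S j al X = dens S j X - 2 * (al * (1 - al)
    + (j%:R - 1 - 1) / (2 * (j%:R - 1)) * (1 - al) ^+ 2).
Proof.
move=> j1 ex; rewrite /sbound /over max_r // /slope /dens /bound /excess /rest.
have j1R : 0 < j%:R - 1 :> R by rewrite subr_gt0 ltr1n.
by rewrite -natr1; field; rewrite !gt_eqF.
Qed.

End PartWeights.

Theorem theorem1p6 (R : realType) (r t : nat) (alpha gamma : R)
  (ht : (2 <= t <= r - 1)%N)
  (halpha : 0 <= alpha <= 1)
  (hgamma : 0 <= gamma <= (r%:R - 2) / (2 * (r%:R - 1)))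
  (n : nat) (V : finType) (hV : #|V| = n) (G : sgraph V)
  (hfree : Kfree G r)
  (hedges : gamma * n%:R ^+ 2 <= #|edges G|%:R)
  (S : {set V}) (hS : #|S|%:Z = Num.ceil (alpha * n%:R)) :
  Num.floor (beta r t alpha gamma * n%:R ^+ t) <= #|Kcopies G S t|%:Z.
Proof.
(* The count is an integer, so the floor disappears; the default value 0 of [xget] gives a trivial
   bound. *)
suff copies b : beta_spec r t alpha gamma b -> b * n%:R ^+ t <= #|Kcopies G S t|%:R.
  rewrite -(@intrKfloor R #|Kcopies G S t|%:Z); apply: le_floor.
  rewrite /beta; case: xgetP => [b _ hb|_]; [exact: copies | by rewrite mul0r ler0n].
have [t2 tr] := andP ht; have [_ al1] := andP halpha; have [_ gle] := andP hgamma.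
have t0 : (0 < t)%N by apply: leq_trans t2.
case: n hV hedges hS => [|n] hV hedges hS.
  by rewrite expr0n eqn0Ngt t0 mulr0 ler0n.
have V0 : (0 < #|V|)%N by rewrite hV.
have alS : alpha * #|V|%:R <= #|S|%:R.
  by rewrite hV; have := ceil_ge (alpha * n.+1%:R); rewrite -hS.
rewrite -hV in hedges *.
(* The index s of [beta] corresponds to S0 = s - 1 large parts and r - s small ones. *)
have split_rs s : (t <= s <= r - 1)%N -> exists S0 j0, [/\ s = S0.+1, r = (S0 + j0).+1,
    (0 < S0)%N & (0 < j0)%N].
  move=> /andP[ts sr]; exists s.-1, (r - s)%N; split; lia.
have from_multi S0 L : (multi S0 t L alpha * #|V|%:R ^+ t <= t`!%:R * #|Kcopies G S t|%:R) ->
   ('C(S0, t)%:R * L ^+ t + 'C(S0, t - 1)%:R * L ^+ (t - 1) * (alpha - S0%:R * L)) * #|V|%:R ^+ t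
   <= #|Kcopies G S t|%:R.
  by rewrite multi_bin // -mulrA ler_pM2l // ltr0n fact_gt0.
have params S0 j D : (0 < S0)%N -> (0 < j)%N -> r = (S0 + j).+1 ->
    D = d r gamma S0.+1 -> S0%:R / (S0 + j)%:R + D <= 1 -> let X := 1 / (S0 + j)%:R + D / S0%:R in
  [/\ S0%:R * X = S0%:R / (S0 + j)%:R + D, 1 <= (S0 + j)%:R * X, S0%:R * X <= 1,
   rest S0 j X = 1 / (S0 + j)%:R - D / j%:R & dens S0 j X = 2 * gamma].
  move=> S0p jp rE DE m1 X.
  have S0R : 0 < S0%:R :> R by rewrite ltr0n.
  have KR : 0 < (S0 + j)%:R :> R by rewrite ltr0n addn_gt0 S0p.
  have SX : S0%:R * X = S0%:R / (S0 + j)%:R + D.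
    by rewrite /X; move: S0R KR; rewrite natrD => *; field; rewrite !gt_eqF.
  have D0 : 0 <= D by rewrite DE sqrtr_ge0.
  split; rewrite ?SX //.
  - rewrite /X mulrDr mul1r mulfV ?gt_eqF // lerDl mulr_ge0 ?ler0n //.
    by rewrite divr_ge0 // ler0n.
  - exact: rest_param.
  - apply: dens_param => //; rewrite DE rE d_sqr //; move: gle; rewrite rE.
    have -> : (S0 + j).+1%:R - 1 = (S0 + j)%:R :> R by rewrite -natr1; ring.
    by have -> : (S0 + j).+1%:R - 2 = (S0 + j)%:R - 1 :> R by rewrite -natr1; ring.
have local S0 j X L : (0 < S0)%N -> (0 < j)%N -> r = (S0 + j).+1 -> 0 < alpha ->
    1 <= (S0 + j)%:R * X -> S0%:R * X <= 1 -> dens S0 j X = 2 * gamma ->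
    S0%:R * L <= alpha <= S0.+1%:R * L -> multi S0 2 L alpha <= sbound S0 j alpha X ->
    multi S0 t L alpha * #|V|%:R ^+ t <= t`!%:R * #|Kcopies G S t|%:R.
  move=> S0p jp rE al0; apply: local_copies hedges => // B cB.
  by have := Kfree_card _ hfree cB; rewrite rE; apply.
case=> [_|s hs|s L hs].
- by rewrite mul0r ler0n.
- have [S0 [j [-> rE S0p jp]]] := split_rs s hs.
  have jR : 0 < j%:R :> R by rewrite ltr0n.
  have S0R : 0 < S0%:R :> R by rewrite ltr0n.
  have KR : 0 < (S0 + j)%:R :> R by rewrite ltr0n addn_gt0 S0p.
  have K1 : r%:R - 1 = (S0 + j)%:R :> R by rewrite rE -natr1; ring.
  have jE : r%:R - S0.+1%:R = j%:R :> R by rewrite rE -!natr1 natrD; ring.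
  have S1 : S0.+1%:R - 1 = S0%:R :> R by rewrite -natr1; ring.
  rewrite subSS subn0 jE K1 S1; set D := d r gamma S0.+1 => /andP[lo hi].
  have D0 : 0 <= D by exact: sqrtr_ge0.
  have [SX kX SX1 Yr dX] := params S0 j D S0p jp rE erefl (le_trans (ltW lo) al1).
  have al0 : 0 < alpha by apply: le_lt_trans lo; rewrite addr_ge0 // divr_ge0 // ltW.
  set X := 1 / _ + _ in SX kX SX1 Yr dX *.
  have -> : alpha - S0%:R / (S0 + j)%:R - D = alpha - S0%:R * X by rewrite SX; ring.
  have YX : rest S0 j X <= X.
    rewrite Yr /X lerD2l; apply: (@le_trans _ _ 0); last by rewrite divr_ge0 // ltW.
    by rewrite oppr_le0 divr_ge0 // ltW.
  (* The upper end of case 2 is S0 X + rest X. Without excess [sbound] is [bound], which is [multi]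
     with L = X. *)
  have ex : excess S0 j alpha X <= 0.
    rewrite /excess SX Yr; move: hi.
    have -> : S0.+1%:R / (S0 + j)%:R + (j%:R - 1) / j%:R * D
      = S0%:R / (S0 + j)%:R + D + (1 / (S0 + j)%:R - D / j%:R).
      by move: KR jR; rewrite natrD -natr1 => *; field; rewrite !gt_eqF.
    lra.
  apply: from_multi; apply: (local S0 j X X) => //.
    rewrite SX ltW //= -natr1 mulrDl mul1r SX; move: ex; rewrite /excess SX.
    by move: YX; lra.
  by rewrite /sbound /over max_l // expr0n mulr0 addr0 multi2 /bound -natr1; lra.
- have sr : (t <= s <= r - 1)%N by lia.
  have [S0 [j [sE rE S0p jp]]] := split_rs s sr; move: hs; rewrite {}sE => hs.
  have j1 : (1 < j)%N by lia.
  have jR : 0 < j%:R :> R by rewrite ltr0n.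
  have j1R : 0 < j%:R - 1 :> R by rewrite subr_gt0 ltr1n.
  have S0R : 0 < S0%:R :> R by rewrite ltr0n.
  have KR : 0 < (S0 + j)%:R :> R by rewrite ltr0n addn_gt0 S0p.
  have K1 : r%:R - 1 = (S0 + j)%:R :> R by rewrite rE -natr1; ring.
  have jE : r%:R - S0.+1%:R = j%:R :> R by rewrite rE -!natr1 natrD; ring.
  have j2 : r%:R - S0.+1%:R - 2 = j%:R - 1 - 1 :> R by rewrite jE; ring.
  have S1 : S0.+1%:R - 1 = S0%:R :> R by rewrite -natr1; ring.
  rewrite /is_L j2 subSS subn0 jE K1 S1.
  set D := d r gamma S0.+1; set D' := d r gamma S0.+2 => /andP[lo hi] [eqL Llo Lhi].
  have D0 : 0 <= D by exact: sqrtr_ge0.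
  (* The lower end of case 3 is a convex combination of S0 / (S0 + j) + D and 1, so alpha <= 1
     bounds the former by 1. *)
  have loE : S0.+1%:R / (S0 + j)%:R + (j%:R - 1) / j%:R * D
      = (S0%:R / (S0 + j)%:R + D) * ((j%:R - 1) / j%:R) + 1 / j%:R.
    by move: KR jR; rewrite natrD -natr1 => *; field; rewrite !gt_eqF.
  have m1 : S0%:R / (S0 + j)%:R + D <= 1.
    rewrite -(ler_pM2r (divr_gt0 j1R jR)) mul1r.
    have jj : (j%:R - 1) / j%:R = 1 - 1 / j%:R :> R by field; rewrite gt_eqF.
    by move: lo; rewrite loE [X in _ <= X]jj; lra.
  have [SX kX SX1 Yr dX] := params S0 j D S0p jp rE erefl m1.
  set X := 1 / _ + D / _ in SX kX SX1 Yr dX.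
  have Y0 : 0 <= rest S0 j X by rewrite divr_ge0 ?subr_ge0 // ltW.
  have ex : 0 < excess S0 j alpha X.
    rewrite /excess SX Yr; move: lo.
    have -> : S0.+1%:R / (S0 + j)%:R + (j%:R - 1) / j%:R * D
      = S0%:R / (S0 + j)%:R + D + (1 / (S0 + j)%:R - D / j%:R).
      by move: KR jR; rewrite natrD -natr1 => *; field; rewrite !gt_eqF.
    lra.
  have m_al : S0%:R / (S0 + j)%:R + D < alpha.
    by move: ex; rewrite /excess SX; lra.
  have al0 : 0 < alpha by apply: le_lt_trans m_al; rewrite addr_ge0 // divr_ge0 // ltW.
  apply: from_multi; apply: (local S0 j X L) => //.
    apply/andP; split; first exact: le_trans Lhi (ltW m_al).
    (* The lower end of the range of L is (s - 1) / s times the upper end for alpha, hence alpha <=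
       s L. *)
    apply: le_trans hi _.
    have sR : 0 < S0.+1%:R :> R by rewrite ltr0n.
    by move: Llo; rewrite -mulrA ler_pM2l // ler_pdivrMl.
  (* Twice the equation in [is_L] says that the edge sum of the comparison graph equals [sbound]. *)
  rewrite sbound_large ?(ltW ex) // dX multi2.
  have C2 : 2 * 'C(S0, 2)%:R = S0%:R * (S0%:R - 1) :> R.
    case: (S0) S0p => [//|[|q]] _; first by rewrite bin_small // subrr !mulr0.
    by rewrite C2_natr -[q.+2%:R]natr1; ring.
  have := congr1 (fun c => c * L ^+ 2) C2; move: eqL; lra.
Qed.
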